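(* Assume (C1), (C2), (C3) and (C4) from the context. If $k\ge2$ is even and $$\frac{\partial^3G_k}{\partial p_1^3}(\mathcal J\times P_1)\cdot\left(\frac{\partial^2G_k}{\partial\nu\partial p_1}(\mathcal J\times P_1)\right)^{-1}\subset\mathbb R_-,$$ where $\mathbb R_-=(-\infty,0)$, then $f_\nu^2$ has a period $k$-tupling bifurcation (with respect to the predicate $\mathcal C_R$) at some point $(\nu^*,x^* )\in\mathcal J\times P_1\times P_2\times\{0\}$.
   Context: Notation. For a map $g\colon D\subset X\to X$, a set $U\subset D$ and a predicate $\mathcal C$ on $X$, $\mathrm{Fix}(g,U,\mathcal C)=\{x\in U: g(x)=x \text{ and } \mathcal C(x)\}$. $\mathcal C_R(x)$ is the predicate ''$R(x)=x$''. For $M\subset\mathbb R\times X$ let $M_\nu=\{x:(\nu,x)\in M\}$ and $f_\nu=f(\nu,\cdot)\colon M_\nu\to X$. Sums, products and inverses of sets of reals are taken elementwise. Definition (period $k$-tupling). Let $g_\nu$ be a one-parameter family of maps with open domain $N\subset\mathbb R\times X$, $\mathcal C$ a predicate on $X$, $k$ a positive integer. $g_\nu$ has a period $k$-tupling bifurcation at $(\nu^*,x^* )\in N$ if there are $V=[\nu_1,\nu_2]\times U'\subset N$ with $(\nu^*,x^* )\in\mathrm{int}\,V$ and functions $x_{fp}\colon[\nu_1,\nu_2]\to\mathrm{int}\,U'$, $x_{b_1},x_{b_2}\colon[\nu^*,\nu_2]\to\mathrm{int}\,U'$, continuous and smooth in the interior of their domains, with $x_{b_1}(\nu^* )=x_{b_2}(\nu^*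 )=x_{fp}(\nu^* )=x^*$, such that (1) $\mathrm{Fix}(g_\nu^p,U',\mathcal C)=\{x_{fp}(\nu)\}$ for $\nu\in[\nu_1,\nu^*]$, $1\le p\le k$; $\mathrm{Fix}(g_\nu^p,U',\mathcal C)=\{x_{fp}(\nu)\}$ for $\nu\in[\nu^*,\nu_2]$, $1\le p<k$; $\mathrm{Fix}(g_\nu^k,U',\mathcal C)=\{x_{fp}(\nu),x_{b_1}(\nu),x_{b_2}(\nu)\}$ for $\nu\in[\nu^*,\nu_2]$; and $\#\mathrm{Fix}(g_\nu^k,U',\mathcal C)=3$ for $\nu\in(\nu^*,\nu_2]$; (2) if $k$ is even, then $g_\nu^{k/2}(x_{b_1}(\nu))=x_{b_2}(\nu)$ and $g_\nu^{k/2}(x_{b_2}(\nu))=x_{b_1}(\nu)$ for $\nu\in(\nu^*,\nu_2]$. Setting. $X$ is a smooth manifold of dimension $2n$, $M\subset\mathbb R\times X$ is open, $f\colon M\to X$ is $\mathcal C^3$, and (C1) whenever $M_\nu\ne\emptyset$, $f_\nu\colon M_\nu\to X$ is a diffeomorphism onto its image. $R\colon X\to X$ is a homeomorphism which is a reversing symmetry for every $f_\nu$: $(R\circ f_\nu)(M_\nu)\subset M_\nu$ and $R^{-1}\circ f_\nu\circ R\circ f_\nu=\mathrm{id}$ on $M_\nu$. $\mathrm{Fix}(R)=\{x:R(x)=x\}$ is an $n$-dimensional submanifold. Fix $k$, a point $(\hat\nu,\hat x)\in M$, an open interval $\mathcal J$ and an open set $U\subset X$ with $(\hat\nu,\hat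 x)\in\mathcal J\times U$ such that $f_\nu^{2k}$ is defined on $U$ for $\nu\in\mathcal J$. There are local coordinates $(p,q)\in\mathbb R^n\times\mathbb R^n$ in $U$ in which $\mathrm{Fix}(R)\cap U=\{(p,q)\in U:q=0\}$; the same symbols denote coordinates near $f_{\hat\nu}(\hat x)$ in which $\mathrm{Fix}(R)$ is likewise given by $q=0$. Split $p=(p_1,p_2)$, $q=(q_1,q_2)\in\mathbb R\times\mathbb R^{n-1}$; $\pi$ with a subscript denotes projection onto the indicated coordinates. There is a smooth curve $\mathcal J\ni\nu\mapsto x_{fp}(\nu)=(p_1(\nu),p_2(\nu),0)\in U$ such that $\mathrm{Fix}(f_\nu^{2i},U,\mathcal C_R)=\{x_{fp}(\nu)\}$ for $\nu\in\mathcal J$ and $i=1,\dots,k-1$. (C2) $P_1$ is a closed interval and $P_2$ a closed set (with $P_1\times P_2\times\{0\}\subset U$) such that $p_1(\nu)\in\mathrm{int}\,P_1$ for $\nu\in\mathcal J$, and the solution set of $\pi_{q_2}(f_\nu^k(p_1,p_2,0))=0$ in $\mathcal J\times P_1\times P_2$ is the graph of a smooth function $p_2=p_2(\nu,p_1)\colon\mathcal J\times P_1\to\mathrm{int}\,P_2$. The bifurcation function is $G_k(\nu,p_1)=\pi_{q_1}(f_\nu^k(p_1,p_2(\nu,p_1),0))$. The curve $x_{fp}$ lies in $P_1\times P_2\times\{0\}$, so $G_k(\nu,p_1(\nu))=0$ and $G_k(\nu,p_1)=(p_1-p_1(\nu))\,g_k(\nu,p_1)$ with the reduced bifurcation function $$g_k(\nu,p_1)=\int_0^1\frac{\partial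 G_k}{\partial p_1}\bigl(\nu,t(p_1-p_1(\nu))+p_1(\nu)\bigr)\,dt .$$ (C3) There is a smooth function $P_1\ni p_1\mapsto\nu(p_1)\in\mathcal J$ such that $\{(\nu,p_1)\in\mathcal J\times P_1:g_k(\nu,p_1)=0\}=\{(\nu(p_1),p_1):p_1\in P_1\}$. (C4) $0\notin\frac{\partial^2G_k}{\partial\nu\partial p_1}(\mathcal J\times P_1)+\frac{\partial^2G_k}{\partial p_1^2}(\mathcal J\times P_1)\,p_1'(\mathcal J)$. *)

(* Defs.v *)
From mathcomp Require Export all_boot all_order all_algebra.
From mathcomp Require Export all_classical all_reals all_analysis.
Set Implicit Arguments.
Unset Strict Implicit.
Unset Printing Implicit Defensive.
Import Order.TTheory GRing.Theory Num.Theory.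
Import numFieldNormedType.Exports.
Local Open Scope classical_set_scope.
Local Open Scope ring_scope.

Section Smoothness.
Context {R : realType}.

(* [Cr r A f]: [f] is of class C^r on the open set [A]; the values of [f]
   outside [A] are irrelevant.  The spaces are finite dimensional in every use,
   so that [x |-> 'd f x] is C^r iff each [x |-> 'd f x v] is. *)
Fixpoint Cr (r : nat) {E F : normedModType R} (A : set E) (f : E -> F) : Prop :=
  match r with
  | 0 => forall x, A x -> {for x, continuous f}
  | r'.+1 => (forall x, A x -> differentiable f x) /\
             (forall v, Cr r' A (fun x => 'd f x v))
  end.

Definition Coo {E F : normedModType R} (A : set E) (f : E -> F) : Prop :=
  forall r, Cr r A f.

(* On a set that need not be open: existence of a smooth extension to an open
   neighbourhood. *)
Definition smooth_on {E F : normedModType R} (A : set E) (f : E -> F) : Prop :=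
  exists O g, [/\ open O, A `<=` O, Coo O g & forall x, A x -> f x = g x].

(* Derivative relative to [A]: one-sided at the end points of an interval. *)
Definition derive_in (A : set R) (h : R -> R) (x : R) : R :=
  lim (t^-1 * (h (x + t) - h x) @[t --> within [set t | A (x + t)] 0^']).

End Smoothness.

Section Manifolds.
Context {R : realType} {X : topologicalType} {E : normedModType R}.

Record chart := Chart {
  cdom : set X;
  ccod : set E;
  cfwd : X -> E;
  cbwd : E -> X;
  cdom_open : open cdom;
  ccod_open : open ccod;
  cfwd_in : forall x, cdom x -> ccod (cfwd x);
  cbwd_in : forall y, ccod y -> cdom (cbwd y);
  cfwdK : forall x, cdom x -> cbwd (cfwd x) = x;
  cbwdK : forall y, ccod y -> cfwd (cbwd y) = y;
  cfwd_cont : forall x, cdom x -> {for x, continuous cfwd};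
  cbwd_cont : forall y, ccod y -> {for y, continuous cbwd} }.

Definition smooth_transition (c c' : chart) : Prop :=
  Coo (ccod c `&` cbwd c @^-1` cdom c') (cfwd c' \o cbwd c).

Definition compatible (c c' : chart) : Prop :=
  smooth_transition c c' /\ smooth_transition c' c.

Record smooth_structure := SmoothStructure {
  atlas : set chart;
  atlas_hausdorff : hausdorff_space X;
  atlas_countable : @second_countable X;
  atlas_cover : forall x, exists2 c, atlas c & cdom c x;
  atlas_compat : forall c c', atlas c -> atlas c' -> compatible c c' }.

Variable S : smooth_structure.

(* Membership in the maximal atlas. *)
Definition local_coordinates (c : chart) : Prop :=
  forall c', atlas S c' -> compatible c c'.

(* C^r maps from an open subset [D] of a normed space into the manifold. *)
Definition Cr_into (r : nat) {E' : normedModType R} (D : set E') (h : E' -> X)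
    : Prop :=
  (forall z, D z -> {for z, continuous h}) /\
  (forall c, atlas S c -> Cr r (D `&` h @^-1` cdom c) (cfwd c \o h)).

Definition smooth_curve (I : set R) (x : R -> X) : Prop :=
  forall r, Cr_into r I x.

(* C^r maps from an open subset [A] of the manifold into the manifold. *)
Definition Cr_map (r : nat) (A : set X) (h : X -> X) : Prop :=
  forall c, atlas S c ->
    Cr_into r (ccod c `&` cbwd c @^-1` A) (h \o cbwd c).

(* [(nu, x) |-> f nu x] is C^r on the open set [M]. *)
Definition Cr_family (r : nat) (M : set (R * X)) (f : R -> X -> X) : Prop :=
  forall c, atlas S c ->
    Cr_into r [set z : R * E | ccod c z.2 /\ M (z.1, cbwd c z.2)]
      (fun z => f z.1 (cbwd c z.2)).

Definition slice (M : set (R * X)) (nu : R) : set X := [set x | M (nu, x)].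

Definition Cr_diffeo_onto_image (r : nat) (A : set X) (h : X -> X) : Prop :=
  [/\ Cr_map r A h, open (h @` A) &
      exists g, (forall x, A x -> g (h x) = x) /\ Cr_map r (h @` A) g].

Definition Fix (g : X -> X) (U : set X) (C : X -> Prop) : set X :=
  [set x | [/\ U x, g x = x & C x]].

(* Domain of [(nu, x) |-> (f nu)^j x] when [f nu] is defined on [slice M nu]. *)
Definition iter_dom (M : set (R * X)) (f : R -> X -> X) (j : nat)
    : set (R * X) :=
  [set z | forall i, (i < j)%N -> M (z.1, iter i (f z.1) z.2)].

Definition period_tupling (N : set (R * X)) (g : R -> X -> X) (C : X -> Prop)
    (k : nat) (nus : R) (xs : X) : Prop :=
  [/\ open N, N (nus, xs) &
  exists (nu1 nu2 : R) (U' : set X) (xfp xb1 xb2 : R -> X),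
  [/\ (`[nu1, nu2] `*` U' `<=` N)
      /\ ((`[nu1, nu2] `*` U')° : set (R * X)) (nus, xs),
      (* the iterates occurring below are defined on [U'] *)
      (forall p, (p <= k)%N -> `[nu1, nu2] `*` U' `<=` iter_dom N g p),
      [/\ (forall nu, nu1 <= nu <= nu2 -> U'° (xfp nu)),
          (forall nu, nus <= nu <= nu2 -> U'° (xb1 nu) /\ U'° (xb2 nu)),
          [/\ {within `[nu1, nu2], continuous xfp},
              {within `[nus, nu2], continuous xb1} &
              {within `[nus, nu2], continuous xb2}],
          [/\ smooth_curve `]nu1, nu2[ xfp,
              smooth_curve `]nus, nu2[ xb1 &
              smooth_curve `]nus, nu2[ xb2] &
          [/\ xb1 nus = xs, xb2 nus = xs & xfp nus = xs]],
      [/\ (forall nu p, nu1 <= nu <= nus -> (1 <= p <= k)%N ->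
             Fix (iter p (g nu)) U' C = [set xfp nu]),
          (forall nu p, nus <= nu <= nu2 -> (1 <= p < k)%N ->
             Fix (iter p (g nu)) U' C = [set xfp nu]),
          (forall nu, nus <= nu <= nu2 ->
             Fix (iter k (g nu)) U' C = [set xfp nu; xb1 nu; xb2 nu]) &
          (forall nu, nus < nu <= nu2 ->
             (Fix (iter k (g nu)) U' C #= `I_3)%card)] &
      (~~ odd k -> forall nu, nus < nu <= nu2 ->
         iter k./2 (g nu) (xb1 nu) = xb2 nu /\
         iter k./2 (g nu) (xb2 nu) = xb1 nu)]].

End Manifolds.
Arguments chart {R} X E.
Arguments smooth_structure {R} X E.

(* The half dimension is [1 + m]; the model space ['rV_((1 + m) + (1 + m))]
   carries the coordinates [(p, q) = ((p1, p2), (q1, q2))]. *)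
Section Coordinates.
Context {R : realType} {m : nat}.
Notation E := 'rV[R]_((1 + m) + (1 + m)).

Definition pi_p (v : E) : 'rV[R]_(1 + m) := lsubmx v.
Definition pi_q (v : E) : 'rV[R]_(1 + m) := rsubmx v.
Definition pi_p1 (v : E) : R := lsubmx (pi_p v) 0 0.
Definition pi_p2 (v : E) : 'rV[R]_m := rsubmx (pi_p v).
Definition pi_q1 (v : E) : R := lsubmx (pi_q v) 0 0.
Definition pi_q2 (v : E) : 'rV[R]_m := rsubmx (pi_q v).

(* The vector [(p1, p2, 0)]. *)
Definition pvec (p1 : R) (p2 : 'rV[R]_m) : E :=
  row_mx (row_mx p1%:M p2 : 'rV[R]_(1 + m)) 0.

Context {X : topologicalType}.
Variable S : smooth_structure X E.

(* In the coordinates [c], the set [F] is [{q = 0}]. *)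
Definition slice_chart (c : chart X E) (F : set X) : Prop :=
  F `&` cdom c = [set x | cdom c x /\ pi_q (cfwd c x) = 0].

(* Embedded submanifold of half the dimension. *)
Definition half_dim_submanifold (F : set X) : Prop :=
  forall x, F x ->
    exists c, [/\ local_coordinates S c, cdom c x & slice_chart c F].

Definition fixed_by (rho : X -> X) (x : X) : Prop := rho x = x.

(* [rho] is a homeomorphism with inverse [rhoV], and reverses every
   [f nu : slice M nu -> X]. *)
Record reversing_symmetry (M : set (R * X)) (f : R -> X -> X)
    (rho rhoV : X -> X) : Prop := {
  reversing_K : cancel rho rhoV;
  reversing_VK : cancel rhoV rho;
  reversing_cont : continuous rho;
  reversing_contV : continuous rhoV;
  reversing_sub : forall nu,
    (rho \o f nu) @` slice M nu `<=` slice M nu;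
  reversing_id : forall nu x, slice M nu x ->
    rhoV (f nu (rho (f nu x))) = x;
  reversing_fix : half_dim_submanifold (fixed_by rho) }.

Variables (phi chi : chart X E) (f : R -> X -> X) (k : nat).

(* [f_nu^k (p1, p2, 0)], the argument being read in the chart [phi] and the
   image in the chart [chi]. *)
Definition iter_coord (nu p1 : R) (p2 : 'rV[R]_m) : E :=
  cfwd chi (iter k (f nu) (cbwd phi (pvec p1 p2))).

Definition bif_fun (p2 : R * R -> 'rV[R]_m) (nu p1 : R) : R :=
  pi_q1 (iter_coord nu p1 (p2 (nu, p1))).

End Coordinates.

Section Derivatives.
Context {R : realType}.
Variables (P1 : set R) (G : R -> R -> R).

Definition dp (nu p1 : R) : R := derive_in P1 (G nu) p1.
Definition dpp (nu p1 : R) : R := derive_in P1 (dp nu) p1.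
Definition dppp (nu p1 : R) : R := derive_in P1 (dpp nu) p1.
Definition dnup (nu p1 : R) : R := derive1 (dp^~ p1) nu.

Definition reduced_bif_fun (pfp : R -> R) (nu p1 : R) : R :=
  \int[lebesgue_measure]_(t in `[0, 1]) dp nu (t * (p1 - pfp nu) + pfp nu).

End Derivatives.

Section SetArithmetic.
Context {R : realType}.

Definition set_add (A B : set R) : set R := [set x + y | x in A & y in B].
Definition set_mul (A B : set R) : set R := [set x * y | x in A & y in B].
Definition set_inv (A : set R) : set R := [set x^-1 | x in A].

Definition image_of_prod (h : R -> R -> R) (A B : set R) : set R :=
  [set h x y | x in A & y in B].

End SetArithmetic.

(* Main.v *)
From HB Require Import structures.
From mathcomp Require Import finmap ring lra.
Require Import Defs.
Set Implicit Arguments.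
Unset Strict Implicit.
Unset Printing Implicit Defensive.
Import Order.TTheory GRing.Theory Num.Theory.
Import numFieldNormedType.Exports.
Local Open Scope classical_set_scope.
Local Open Scope ring_scope.

(** Why the theorem holds.  Write f for f_nu, and X(nu, p) for the symmetric
    point with coordinates (p, p2(nu, p), 0).

    Reversibility.  Since f R f = R, forward iteration from R(f^k x) retraces
    the orbit of x backwards.  Hence, for x in Fix(R), the point f^k x lies in
    Fix(R) if and only if f^(2k) x = x ([return_symmetric]).  By (C2) the former
    condition is an equation in coordinates: near the fixed point curve, the
    symmetric 2k-periodic points are the X(nu, p) with G(nu, p) = 0
    ([symmetric_return_zero], [zero_return]).  By (C3) such a zero has
    p = p1(nu), which is the fixed point, or nu = nu(p).  It remains to
    understand the curve nu(p) and how it meets the curve p1(nu).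

    One crossing.  The slope h(nu) = dG/dp (nu, p1(nu)) has derivative
    G_nup + G_pp p1', which never vanishes by (C4), so h is injective.  At a
    crossing p = p1(nu(p)) the reduced bifurcation function is zero, that is
    h(nu(p)) = 0; hence there is at most one crossing p0, and there is one by
    the intermediate value theorem, as p1 stays inside P1 ([crossing_exists],
    [crossing_unique]).

    The partner.  If G(nu(p), p) = 0, then f^k X(nu(p), p) is again symmetric
    and 2k-periodic, so near p0 it is X(nu(p), s(p)) for some s(p), and s is a
    continuous involution which preserves nu( ).  As k is even, f^k is the
    (k/2)-th iterate of f^2, whose only symmetric fixed point is the one on the
    given curve; so s(p) = p only at the crossing, and s exchanges the two sides
    of p0 ([partner_opposite]).  For p <> p0 the function G(nu(p), .) thus has
    the three zeros p, p1(nu(p)), s(p), with p1(nu(p)) in the middle.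

    Counting zeros.  By hypothesis G_ppp and G_nup do not vanish and have
    opposite signs.  By Rolle, G(nu, .) has at most three zeros, and if it has
    three the outer ones are simple.  So nu( ) is injective on either side of p0
    with nu'(p) <> 0, and h(nu(p)), the slope at the middle zero, has the sign
    of G_nup.  Letting p tend to p0 one finds G_pp = 0 at the crossing, so that
    h' = G_nup there; since h is injective and vanishes at nu(p0), this gives
    nu(p) > nu(p0) for all p <> p0 close to p0 ([pitchfork_shape]).

    Branches.  The two inverses of nu( ) near p0 parametrize the bifurcating
    orbits over [nu(p0), nu2]; they are smooth because nu' <> 0, and f^k
    exchanges them because s does ([branches_tupling]). *)

(** * Calculus of C^r maps between normed spaces *)

(** Declared as an instance, this lets [diff_bilin] differentiate the product of
    a scalar function and a vector function. *)
Lemma scale_is_bilinear (R : realType) (F : normedModType R) :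
  bilinear_for
    (GRing.Scale.Law.clone _ _ *:%R _) (GRing.Scale.Law.clone _ _ *:%R _)
    (@GRing.scale R F : R^o -> F -> F).
Proof.
split=> [u'|u] a x y /=.
- by rewrite scalerDl scalerA.
- by rewrite scalerDr !scalerA mulrC.
Qed.
HB.instance Definition _ (R : realType) (F : normedModType R) :=
  bilinear_isBilinear.Build R R^o F F _ _ (@GRing.scale R F)
    (@scale_is_bilinear R F).

Section Cr_calculus.
Context {R : realType}.
Implicit Types E F H : normedModType R.

Lemma Cr_sub r E F (A B : set E) (f : E -> F) : B `<=` A -> Cr r A f -> Cr r B f.
Proof.
elim: r f => [|r IH] f BA /=; first by move=> h x /BA; exact: h.
by move=> [h1 h2]; split=> [x /BA|v]; [exact: h1|exact: IH].
Qed.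

Lemma CrW r E F (A : set E) (f : E -> F) : Cr r.+1 A f -> Cr r A f.
Proof.
elim: r f => [|r IH] f /= [h1 h2].
  by move=> x Ax; exact/differentiable_continuous/h1.
by split=> // v; exact/IH/h2.
Qed.

Lemma Cr_cont r E F (A : set E) (f : E -> F) x :
  Cr r A f -> A x -> {for x, continuous f}.
Proof. by elim: r f => [|r IH] f //; [apply|move=> /CrW/IH]. Qed.

(** The first order expansion of [f] at [x] only sees the germ of [f], so it is
    an expansion of [g]. *)
Lemma near_eq_diff_expansion E F (f g : E -> F) x :
  {near x, f =1 g} -> differentiable f x ->
  continuous ('d f x) /\ g \o shift x = cst (g x) + 'd f x +o_ 0 id.
Proof.
move=> fg df; have [c /eqaddoP e] := (diff_locallyP x f).1 df.
split=> //; apply/eqaddoP => eps eps0; have := e eps eps0.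
have fgx : f x = g x by exact: nbhs_singleton fg.
have fg0 : \forall y \near (0 : E), f (y + x) = g (y + x).
  have : (fun y : E => y + x) @ (0 : E) --> 0 + x.
    by apply: cvgD; [exact: cvg_id|exact: cvg_cst].
  by rewrite add0r => h; exact: h _ fg.
apply: filterS2 fg0 => y fgy; rewrite !fctE /= => h.
by rewrite -fgy -fgx.
Qed.

Lemma near_eq_differentiable E F (f g : E -> F) x :
  {near x, f =1 g} -> differentiable f x -> differentiable g x.
Proof.
move=> fg df; apply/diff_locallyP; have [c e] := near_eq_diff_expansion fg df.
rewrite (_ : ('d g x : E -> F) = 'd f x); first by [].
exact: diff_unique.
Qed.

Lemma near_eq_diff E F (f g : E -> F) x :
  {near x, f =1 g} -> differentiable f x -> 'd g x = 'd f x :> (E -> F).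
Proof. by move=> fg /(near_eq_diff_expansion fg)[c e]; exact: diff_unique. Qed.

(** As [A] is open, the functions have equal germs on [A], hence equal
    differentials, and the induction can go on with these. *)
Lemma Cr_ext r E F (A : set E) (f g : E -> F) : open A ->
  (forall x, A x -> f x = g x) -> Cr r A f -> Cr r A g.
Proof.
move=> oA; elim: r f g => [|r IH] f g fg /=.
  move=> h x Ax; have := h x Ax; rewrite /prop_for /continuous_at -(fg _ Ax).
  apply: cvg_trans; apply: near_eq_cvg.
  by near=> y; apply/fg; near: y; exact: open_nbhs_nbhs.
move=> [h1 h2]; have nfg x : A x -> {near x, f =1 g}.
  by move=> Ax; near=> y; apply/fg; near: y; exact: open_nbhs_nbhs.
split=> [x Ax|v]; first by apply: near_eq_differentiable (h1 _ Ax); exact: nfg.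
apply: IH (h2 v) => x Ax; rewrite (near_eq_diff (nfg _ Ax))//; exact: h1.
Unshelve. all: by end_near. Qed.

(** The set [B] may depend on the point: this is what allows a change of chart
    along the domain. *)
Lemma Cr_local r E F (A : set E) (f : E -> F) :
  (forall x, A x -> exists2 B : set E, B x & Cr r B f) -> Cr r A f.
Proof.
elim: r f => [|r IH] f h.
  by move=> x /h[B Bx] hB; exact: hB.
split=> [x /h[B Bx [h1 _]]|v]; first exact: h1.
by apply: IH => x /h[B Bx [_ hB]]; exists B => //; exact: hB.
Qed.

Lemma Cr_cst r E F (A : set E) (c : F) : Cr r A (fun=> c).
Proof.
elim: r c => [|r IH] c /=; first by move=> x _; exact: cst_continuous.
split=> [x _|v]; first exact: differentiable_cst.
rewrite (_ : (fun x => _) = fun=> 0); first exact: IH.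
by apply/funext => x; rewrite diff_cst.
Qed.

Lemma Cr_lin r E F (A : set E) (f : {linear E -> F}) : continuous f -> Cr r A f.
Proof.
move=> cf; case: r => [|r] /=; first by move=> x _; exact: cf.
split=> [x _|v]; first exact: linear_differentiable.
rewrite (_ : (fun x => _) = fun=> f v); first exact: Cr_cst.
by apply/funext => x; rewrite diff_lin.
Qed.

Lemma Cr_D r E F (A : set E) (f g : E -> F) : open A ->
  Cr r A f -> Cr r A g -> Cr r A (fun x => f x + g x).
Proof.
move=> oA; elim: r f g => [|r IH] f g.
  by move=> hf hg x Ax; apply: continuousD; [exact: hf|exact: hg].
move=> [f1 f2] [g1 g2]; split=> [x Ax|v].
  by apply: differentiableD; [exact: f1|exact: g1].
apply: Cr_ext (IH _ _ (f2 v) (g2 v)) => // x Ax.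
exact: esym (congr1 (fun h : E -> F => h v) (diffD (f1 x Ax) (g1 x Ax))).
Qed.

Lemma Cr_sum r E F (A : set E) n (f : 'I_n -> E -> F) : open A ->
  (forall i, Cr r A (f i)) -> Cr r A (fun x => \sum_i f i x).
Proof.
move=> oA; elim: n f => [|n IH] f h.
  by rewrite (_ : (fun x => _) = fun=> 0); [exact: Cr_cst|apply/funext => x; rewrite big_ord0].
rewrite (_ : (fun x => _) = fun x => f ord0 x + \sum_i f (lift ord0 i) x); last first.
  by apply/funext => x; rewrite big_ord_recl.
by apply: Cr_D => //; exact: IH.
Qed.

Lemma is_diffZf E F (a : E -> R) (f : E -> F) x : differentiable a x ->
  differentiable f x ->
  differentiable (fun y => a y *: f y) x /\
  forall v, 'd (fun y => a y *: f y) x v = 'd a x v *: f x + a x *: 'd f x v.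
Proof.
move=> da df.
have c : continuous (fun p : R * F => p.1 *: p.2).
  by move=> p; apply: scale_continuous.
have dp := differentiable_pair da df.
have ds : differentiable (fun p : R * F => p.1 *: p.2) (a x, f x).
  exact: (differentiable_bilin (f := @GRing.scale R F)).
have -> : (fun y => a y *: f y) = (fun p : R * F => p.1 *: p.2) \o (fun y => (a y, f y)) by [].
split=> [|v]; first exact: differentiable_comp.
by rewrite diff_comp//= diff_pair// (diff_bilin (f := @GRing.scale R F))//= addrC.
Qed.

Lemma Cr_Z r E F (A : set E) (a : E -> R) (f : E -> F) : open A ->
  Cr r A a -> Cr r A f -> Cr r A (fun x => a x *: f x).
Proof.
move=> oA; elim: r a f => [|r IH] a f.
  by move=> ha hf x Ax; apply: continuousZ; [exact: ha|exact: hf].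
move=> ha hf; have [a1 a2] := ha; have [f1 f2] := hf; split=> [x Ax|v].
  by have [] := is_diffZf (a1 x Ax) (f1 x Ax).
have := Cr_D oA (IH _ _ (a2 v) (CrW hf)) (IH _ _ (CrW ha) (f2 v)).
apply: Cr_ext => // x Ax.
by have [_ ->] := is_diffZf (a1 x Ax) (f1 x Ax).
Qed.

Lemma Cr_M r E (A : set E) (a b : E -> R) : open A ->
  Cr r A a -> Cr r A b -> Cr r A (fun x => a x * b x).
Proof. exact: (@Cr_Z r E R). Qed.

Lemma Cr_pair r E F H (A : set E) (f : E -> F) (g : E -> H) : open A ->
  Cr r A f -> Cr r A g -> Cr r A (fun x => (f x, g x)).
Proof.
move=> oA; elim: r f g => [|r IH] f g.
  by move=> hf hg x Ax; apply: cvg_pair; [exact: hf|exact: hg].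
move=> [f1 f2] [g1 g2]; split=> [x Ax|v].
  by apply: differentiable_pair; [exact: f1|exact: g1].
apply: Cr_ext (IH _ _ (f2 v) (g2 v)) => // x Ax.
by rewrite (diff_pair (f1 x Ax) (g1 x Ax)).
Qed.

Lemma Cr_lin_comp r E F H (A : set E) (l : {linear F -> H}) (f : E -> F) :
  open A -> continuous l -> Cr r A f -> Cr r A (l \o f).
Proof.
move=> oA cl; elim: r f => [|r IH] f.
  by move=> h x Ax; apply: continuous_comp; [exact: h|exact: cl].
move=> [f1 f2]; split=> [x Ax|v].
  by apply: differentiable_comp; [exact: f1|exact: linear_differentiable].
apply: Cr_ext (IH _ (f2 v)) => // x Ax.
rewrite diff_comp//=; [|exact: f1|exact: linear_differentiable].
by rewrite diff_lin.
Qed.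

(** Finite dimension, in the form in which the chain rule uses it: the dual
    forms [l i] split a vector into scalars. *)
Definition finite_frame F := exists n (e : 'I_n -> F) (l : 'I_n -> {linear F -> R^o}),
  (forall i, continuous (l i)) /\ forall v, v = \sum_i l i v *: e i.

Lemma finite_frame_continuous F H (f : {linear F -> H}) :
  finite_frame F -> continuous f.
Proof.
move=> [n [e [l [cl ll]]]].
have -> : (f : F -> H) = fun v => \sum_i l i v *: f (e i).
  apply/funext => v; rewrite {1}(ll v) linear_sum.
  by apply: eq_bigr => i _; rewrite linearZ.
move=> x; apply: (@Cr_sum 0 _ _ setT _ (fun i v => l i v *: f (e i))) => //.
  exact: openT.
move=> i y _; apply: (@continuousZ _ _ _ (l i) (fun=> f (e i))); first exact: cl.
exact: cst_continuous.
Qed.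

(** The differential of [g \o f] in the direction [v] is ['d g (f x)] at the
    vector ['d f x v], which moves with [x].  A frame expands that vector, and
    what remains are products of scalar functions with the maps
    [x |-> 'd g (f x) (e i)], to which the induction hypothesis applies. *)
Lemma Cr_comp r E F H (A : set E) (B : set F) (f : E -> F) (g : F -> H) :
  finite_frame F -> open A -> (forall x, A x -> B (f x)) ->
  Cr r A f -> Cr r B g -> Cr r A (g \o f).
Proof.
move=> [n [e [l [cl ll]]]] oA AB; elim: r g => [|r IH] g.
  by move=> hf hg x Ax; apply: continuous_comp; [exact: hf|apply: hg; exact: AB].
move=> hf [g1 g2]; have [f1 f2] := hf; split=> [x Ax|v].
  by apply: differentiable_comp; [exact: f1|apply/g1/AB].
apply: (@Cr_ext _ _ _ _ (fun x => \sum_i (l i ('d f x v)) *: 'd g (f x) (e i))) => //.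
  move=> x Ax; rewrite (diff_comp (f1 x Ax) (g1 _ (AB _ Ax)))/=.
  rewrite [in RHS](ll ('d f x v)) linear_sum/=.
  by apply: eq_bigr => i _; rewrite linearZ.
apply: Cr_sum => // i; apply: Cr_Z => //.
  exact: (Cr_lin_comp oA (cl i) (f2 v)).
exact: (IH _ (CrW hf) (g2 (e i))).
Qed.

Lemma Cr_id r E (A : set E) : Cr r A (fun x => x).
Proof. by apply: (@Cr_lin _ _ _ _ (@idfun E : {linear E -> E})) => x; exact: cvg_id. Qed.

Lemma Cr_fst r E F H (A : set E) (f : E -> F * H) : open A ->
  Cr r A f -> Cr r A (fun x => (f x).1).
Proof.
move=> oA hf.
have lin : linear (fun v : F * H => v.1) by [].
pose l : {linear (F * H)%type -> F} := HB.pack (fun v : F * H => v.1)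
  (GRing.isLinear.Build _ _ _ _ _ lin).
by apply: (Cr_lin_comp (l := l) oA _ hf) => x; exact: cvg_fst.
Qed.

Lemma Cr_snd r E F H (A : set E) (f : E -> F * H) : open A ->
  Cr r A f -> Cr r A (fun x => (f x).2).
Proof.
move=> oA hf.
have lin : linear (fun v : F * H => v.2) by [].
pose l : {linear (F * H)%type -> H} := HB.pack (fun v : F * H => v.2)
  (GRing.isLinear.Build _ _ _ _ _ lin).
by apply: (Cr_lin_comp (l := l) oA _ hf) => x; exact: cvg_snd.
Qed.

Lemma finite_frame_R : finite_frame (R : normedModType R).
Proof.
exists 1%N, (fun=> 1), (fun=> (@idfun R^o : {linear R^o -> R^o})); split.
  by move=> _ x; exact: cvg_id.
by move=> v; rewrite big_ord_recl big_ord0 addr0 /= /GRing.scale/= mulr1.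
Qed.

Lemma finite_frame_rV n : finite_frame ('rV[R]_n : normedModType R).
Proof.
have lin i : linear (fun v : 'rV[R]_n => v 0 i : R^o).
  by move=> a u v; rewrite !mxE.
pose l i : {linear 'rV[R]_n -> R^o} := HB.pack (fun v : 'rV[R]_n => v 0 i : R^o)
  (GRing.isLinear.Build _ _ _ _ _ (lin i)).
exists n, (fun i => delta_mx 0 i), l; split.
  by move=> i; exact: coord_continuous.
by move=> v; exact: row_sum_delta.
Qed.

Lemma finite_frame_prod F H : finite_frame F -> finite_frame H -> finite_frame (F * H)%type.
Proof.
move=> [n [e [l [cl ll]]]] [m [e' [l' [cl' ll']]]].
have lin1 i : linear (fun v : F * H => l i v.1) by move=> a u v /=; rewrite linearP.
have lin2 i : linear (fun v : F * H => l' i v.2) by move=> a u v /=; rewrite linearP.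
pose L1 i : {linear (F * H)%type -> R^o} := HB.pack (fun v : F * H => l i v.1)
  (GRing.isLinear.Build _ _ _ _ _ (lin1 i)).
pose L2 i : {linear (F * H)%type -> R^o} := HB.pack (fun v : F * H => l' i v.2)
  (GRing.isLinear.Build _ _ _ _ _ (lin2 i)).
exists (n + m)%N, (fun i => match fintype.split i with inl j => (e j, 0) | inr j => (0, e' j) end),
  (fun i => match fintype.split i with inl j => L1 j | inr j => L2 j end); split.
  move=> i; case: (fintype.split i) => j x /=.
    by apply: continuous_comp; [exact: cvg_fst|exact: cl].
  by apply: continuous_comp; [exact: cvg_snd|exact: cl'].
move=> v; rewrite big_split_ord/=.
under eq_bigr => i _ do rewrite (unsplitK (inl i)).
under [X in _ = _ + X]eq_bigr => i _ do rewrite (unsplitK (inr i)).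
have -> : \sum_(i < n) L1 i v *: (e i, 0) = (v.1, 0) :> F * H.
  rewrite [X in (X, _)](ll v.1).
  apply: (big_ind2 (fun (x : F * H) (y : F) => x = (y, 0))) => //.
    by move=> _ x2 _ y2 -> ->; congr pair; rewrite addr0.
  by move=> i _; congr pair; rewrite scaler0.
have -> : \sum_(i < m) L2 i v *: (0, e' i) = (0, v.2) :> F * H.
  rewrite [X in (_, X)](ll' v.2).
  apply: (big_ind2 (fun (x : F * H) (y : H) => x = (0, y))) => //.
    by move=> _ x2 _ y2 -> ->; congr pair; rewrite addr0.
  by move=> i _; congr pair; rewrite scaler0.
by case: v => v1 v2 /=; congr pair; rewrite ?addr0 ?add0r.
Qed.

Lemma Cr_inv r (A : set R) : (forall x, A x -> x != 0) -> open A ->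
  Cr r A (fun x : R => x^-1).
Proof.
move=> A0 oA; elim: r => [|r IH].
  by move=> x /A0 x0; exact: inv_continuous.
split=> [x /A0|v]; first exact: differentiable_Rinv.
suff : Cr r A (fun x : R => - v * (x^-1 * x^-1)).
  apply: Cr_ext => // x /A0 x0; rewrite diff_Rinv//=.
  by rewrite -[RHS]/(- (x ^+ 2)^-1 * v) expr2 invfM mulrC mulrN mulNr.
apply: Cr_M => //; first exact: Cr_cst.
exact: Cr_M.
Qed.

(** The derivative of [u] is the inverse of ['d n _ 1], composed with [u]
    itself; thus [u] is one order smoother than it is already known to be. *)
Lemma Cr_inverse r (A B : set R) (n u : R -> R) : open A -> open B ->
  (forall x, A x -> B (u x)) -> (forall x, A x -> {for x, continuous u}) ->
  (forall x, A x -> n (u x) = x) -> (forall y, B y -> u (n y) = y) ->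
  Coo B n -> (forall y, B y -> 'd n y 1 != 0) -> Cr r A u.
Proof.
move=> oA oB AB cu nK uK Cn n0.
have du x : A x -> is_derive x 1 u ('d n (u x) 1)^-1.
  move=> Ax; rewrite -{1}(nK x Ax); apply: is_derive_inverse.
  - by near=> y; apply: uK; near: y; apply: open_nbhs_nbhs; split => //; exact: AB.
  - by near=> y; apply: (Cr_cont (Cn 0)); near: y; apply: open_nbhs_nbhs; split => //; exact: AB.
  - have dn : differentiable n (u x) by apply: (Cn 1%N).1; exact: AB.
    have dn1 : derivable n (u x) 1 by exact: diff_derivable.
    by have := derivableP dn1; rewrite deriveE.
  - exact/n0/AB.
have dfu x : A x -> differentiable u x.
  by move=> Ax; apply/derivable1_diffP; exact: (@ex_derive _ _ _ _ _ _ _ (du x Ax)).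
elim: r => [|r IH]; first exact: cu.
split=> // v.
suff : Cr r A (fun x => v * ('d n (u x) 1)^-1).
  apply: (Cr_ext oA) => x Ax; have dx := du x Ax.
  have -> : ('d n (u x) 1)^-1 = derive1 u x by rewrite derive1E (@derive_val _ _ _ _ _ _ _ dx).
  exact: esym (congr1 (fun h : R -> R => h v) (diff1E (dfu x Ax))).
apply: Cr_M => //; first exact: Cr_cst.
have h1 : Cr r A (fun x => 'd n (u x) 1).
  exact: (Cr_comp finite_frame_R oA AB IH ((Cn r.+1).2 1)).
apply: (Cr_comp finite_frame_R oA _ h1 (@Cr_inv r [set x | x != 0] _ _)) => //=.
  by move=> x Ax; exact/n0/AB.
Unshelve. all: by end_near. Qed.

End Cr_calculus.

(** * Real analysis in one variable *)
Section real_tools.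
Context {R : realType}.
Implicit Types (f df : R -> R) (u v : R).

Lemma is_derive_continuous f (x d : R) : is_derive x 1 f d -> {for x, continuous f}.
Proof. by case=> h _; exact/differentiable_continuous/derivable1_diffP. Qed.

Lemma within_for_continuous f u v :
  (forall x, u <= x <= v -> {for x, continuous f}) -> {within `[u, v], continuous f}.
Proof.
move=> h; apply: continuous_in_subspaceT => x; rewrite inE/= in_itv/=.
exact: h.
Qed.

Lemma MVT_oo f df u v : u < v ->
  (forall x, u <= x <= v -> is_derive x 1 f (df x)) ->
  exists2 c, u < c < v & f v - f u = df c * (v - u).
Proof.
move=> uv h; have [||c] := @MVT R f df u v uv.
- by move=> x; rewrite in_itv/= => /andP[/ltW ux /ltW xv]; apply: h; rewrite ux xv.
- by apply: within_for_continuous => x /h/is_derive_continuous.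
- by rewrite in_itv/= => ? ?; exists c.
Qed.

Lemma Rolle_oo f df u v : u < v ->
  (forall x, u <= x <= v -> is_derive x 1 f (df x)) -> f u = 0 -> f v = 0 ->
  exists2 c, u < c < v & df c = 0.
Proof.
move=> uv h fu fv; have [c cuv] := MVT_oo uv h.
rewrite fu fv subrr => /esym/eqP; rewrite mulf_eq0 subr_eq0 => /orP[/eqP ?|/eqP e].
  by exists c.
by move: uv; rewrite e ltxx.
Qed.

Lemma IVT_zero f u v : u <= v -> (forall x, u <= x <= v -> {for x, continuous f}) ->
  f u * f v <= 0 -> exists2 c, u <= c <= v & f c = 0.
Proof.
move=> uv h fuv; have [||c] := @IVT R f u v 0 uv.
- exact: within_for_continuous.
- by rewrite ge_min le_max; apply/andP; split; apply: contraT;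
    rewrite negb_or -!ltNge => /andP[h1 h2]; nra.
- by move=> cuv ?; exists c => //; move: cuv; rewrite ?inE ?in_itv/=.
Qed.

(** If [x] and [s x] were both in [S], then [s t - t] would take opposite values
    at these two points and vanish in between. *)
Lemma involution_escapes (s : R -> R) (S : set R) : is_interval S ->
  (forall x, S x -> {for x, continuous s}) -> (forall x, S x -> s x <> x) ->
  forall x, S x -> s (s x) = x -> ~ S (s x).
Proof.
move=> iS cs nfix; suff key x y : S x -> S y -> x <= y ->
    (s x - x) * (s y - y) <= 0 -> False.
  move=> x Sx ssx Ssx; have [le|/ltW le] := leP x (s x).
    by apply: (key _ _ Sx Ssx le); rewrite ssx; nra.
  by apply: (key _ _ Ssx Sx le); rewrite ssx; nra.
move=> Sx Sy xy /(IVT_zero (f := fun t => s t - t) xy)[|c cxy /eqP].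
  move=> t txy; apply: continuousB; last exact: cvg_id.
  by apply: cs; apply: (iS x y).
rewrite subr_eq0 => /eqP; apply: nfix.
by apply: (iS x y).
Qed.

(** The positive slope makes [h] negative just to the left of [n0]; a positive
    value further to the left would produce a second zero of [h]. *)
Lemma positive_right_of_zero (h : R -> R) (J : set R) n0 d : is_interval J ->
  (forall x, J x -> {for x, continuous h}) ->
  (forall x y, J x -> J y -> h x = h y -> x = y) ->
  J n0 -> h n0 = 0 -> is_derive n0 1 h d -> 0 < d ->
  forall x, J x -> 0 < h x -> n0 < x.
Proof.
move=> iJ ch ih Jn h0 dh d0 x Jx hx; rewrite ltNge; apply/negP => xn.
have {}xn : x < n0.
  by rewrite lt_neqAle xn andbT; apply/eqP => e; move: hx; rewrite e h0 ltxx.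
have [y /andP[xy yn] hy] : exists2 y, x < y < n0 & h y < 0.
  have [g [gE cg gn]] := (is_derive1_caratheodory h n0 d).1 dh.
  have : \forall y \near n0, 0 < g y.
    by move: cg => /cvgr_gt; apply; rewrite gn.
  move=> /nbhs_ballP[e /= e0 he].
  pose y := Num.max ((x + n0) / 2) (n0 - e / 2).
  have yn : y < n0 by rewrite /y gt_max; apply/andP; split; lra.
  exists y; first by rewrite yn andbT /y lt_max; apply/orP; left; lra.
  have gy : 0 < g y.
    apply: he; rewrite /ball/= ger0_norm; last by rewrite subr_ge0 ltW.
    by rewrite ltrBlDr -ltrBlDl /y lt_max; apply/orP; right; lra.
  by move: (gE y); rewrite h0 subr0 => ->; nra.
have [||c /andP[xc cy] hc] := @IVT_zero h x y (ltW xy).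
- move=> t /andP[xt ty]; apply: ch; apply: (iJ x n0) => //.
  by rewrite xt /= (le_trans ty) // ltW.
- by nra.
have Jc : J c by apply: (iJ x n0) => //; rewrite xc (le_trans cy)// ltW.
have := ih _ _ Jc Jn; rewrite hc h0 => /(_ erefl) e.
by move: yn; rewrite -e ltNge cy.
Qed.

End real_tools.

Section zero_counting.
Context {R : realType} (a b : R) (F F1 F2 F3 : R -> R).
Hypothesis dF : forall x, a < x < b -> is_derive x 1 F (F1 x).
Hypothesis dF1 : forall x, a < x < b -> is_derive x 1 F1 (F2 x).
Hypothesis dF2 : forall x, a < x < b -> is_derive x 1 F2 (F3 x).
Hypothesis F3_neq0 : forall x, a < x < b -> F3 x != 0.

Let inab x y z : a < x -> z < b -> x <= y <= z -> a < y < b.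
Proof. by move=> ax zb /andP[xy yz]; rewrite (lt_le_trans ax)//= (le_lt_trans yz). Qed.

Lemma no_three_critical_points x y z : a < x -> x < y -> y < z -> z < b ->
  F1 x = 0 -> F1 y = 0 -> F1 z = 0 -> False.
Proof.
move=> ax xy yz zb Fx Fy Fz.
have [c /andP[xc cy] Fc] : exists2 c, x < c < y & F2 c = 0.
  by apply: (Rolle_oo xy _ Fx Fy) => t txy; apply: dF1; apply: inab txy; lra.
have [d /andP[yd dz] Fd] : exists2 d, y < d < z & F2 d = 0.
  by apply: (Rolle_oo yz _ Fy Fz) => t txy; apply: dF1; apply: inab txy; lra.
have cd : c < d by lra.
have [e /andP[ce ed] Fe] : exists2 e, c < e < d & F3 e = 0.
  by apply: (Rolle_oo cd _ Fc Fd) => t txy; apply: dF2; apply: inab txy; lra.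
have /F3_neq0 : a < e < b by lra.
by rewrite Fe eqxx.
Qed.

Lemma zeros_critical x y : a < x -> x < y -> y < b -> F x = 0 -> F y = 0 ->
  exists2 c, x < c < y & F1 c = 0.
Proof.
move=> ax xy yb Fx Fy.
by apply: (Rolle_oo xy _ Fx Fy) => t txy; apply: dF; apply: inab txy; lra.
Qed.

Lemma no_four_zeros x y z w : a < x -> x < y -> y < z -> z < w -> w < b ->
  F x = 0 -> F y = 0 -> F z = 0 -> F w = 0 -> False.
Proof.
move=> ax xy yz zw wb Fx Fy Fz Fw.
have [|c /andP[xc cy] Fc] := zeros_critical ax xy _ Fx Fy; first by lra.
have [| |d /andP[yd dz] Fd] := zeros_critical _ yz _ Fy Fz; [lra|lra|].
have [|e /andP[ze ew] Fe] := zeros_critical _ zw wb Fz Fw; first by lra.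
by apply: (no_three_critical_points _ _ _ _ Fc Fd Fe); lra.
Qed.

Lemma simple_outer_zeros x y z : a < x -> x < y -> y < z -> z < b ->
  F x = 0 -> F y = 0 -> F z = 0 -> F1 x != 0 /\ F1 z != 0.
Proof.
move=> ax xy yz zb Fx Fy Fz.
have [|c /andP[xc cy] Fc] := zeros_critical ax xy _ Fx Fy; first by lra.
have [|d /andP[yd dz] Fd] := zeros_critical _ yz zb Fy Fz; first by lra.
split; apply/eqP => F0.
  by apply: (no_three_critical_points ax xc _ _ F0 Fc Fd); lra.
by apply: (no_three_critical_points _ _ dz zb Fc Fd F0); lra.
Qed.

(** [F1] vanishes on both sides of [y].  By the mean value theorem [F2] takes a
    value with the sign of [F1 y] to the left of [y] and one with the opposite
    sign to the right, and the sign of [F3] somewhere in between follows. *)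
Lemma middle_zero x y z : a < x -> x < y -> y < z -> z < b ->
  F x = 0 -> F y = 0 -> F z = 0 ->
  (exists2 c, x < c < z & F2 c = 0) /\
  exists2 e, x < e < z & F1 y * F3 e < 0.
Proof.
move=> ax xy yz zb Fx Fy Fz.
have [|c /andP[xc cy] Fc] := zeros_critical ax xy _ Fx Fy; first by lra.
have [|d /andP[yd dz] Fd] := zeros_critical _ yz zb Fy Fz; first by lra.
split.
  have cd : c < d by lra.
  have [e /andP[ce ed] Fe] : exists2 e, c < e < d & F2 e = 0.
    by apply: (Rolle_oo cd _ Fc Fd) => t txy; apply: dF1; apply: inab txy; lra.
  by exists e => //; lra.
have [u /andP[cu uy] eu] : exists2 u, c < u < y & F1 y - F1 c = F2 u * (y - c).
  by apply: (MVT_oo cy) => t txy; apply: dF1; apply: inab txy; lra.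
have [v /andP[yv vd] ev] : exists2 v, y < v < d & F1 d - F1 y = F2 v * (d - y).
  by apply: (MVT_oo yd) => t txy; apply: dF1; apply: inab txy; lra.
have uv : u < v by lra.
have [e /andP[ue ve] ee] : exists2 e, u < e < v & F2 v - F2 u = F3 e * (v - u).
  by apply: (MVT_oo uv) => t txy; apply: dF2; apply: inab txy; lra.
exists e; first by lra.
have F1y0 : F1 y != 0.
  by apply/eqP => F0; apply: (no_three_critical_points _ cy yd _ Fc F0 Fd); lra.
rewrite Fc subr0 in eu; rewrite Fd sub0r in ev.
have k1 : 0 < F1 y * F2 u.
  rewrite eu mulrAC -expr2 pmulr_rgt0; first by lra.
  rewrite lt_neqAle sqr_ge0 eq_sym sqrf_eq0 andbT.
  by apply: contra F1y0 => /eqP e0; rewrite eu e0 mul0r.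
have k2 : F1 y * F2 v < 0.
  rewrite -(opprK (F1 y)) ev mulNr mulrAC -expr2 oppr_lt0 pmulr_rgt0; first by lra.
  rewrite lt_neqAle sqr_ge0 eq_sym sqrf_eq0 andbT.
  by apply: contra F1y0 => /eqP e0; rewrite -oppr_eq0 ev e0 mul0r.
have : F1 y * (F3 e * (v - u)) < 0 by rewrite -ee mulrBr; lra.
by rewrite mulrA pmulr_llt0 // subr_gt0.
Qed.

End zero_counting.

(** * Crossing of a curve of fixed points by a curve of zeros *)

(** [Gp], [Gpp], [Gppp] are the successive derivatives of [G] in [p] and [Gnp]
    is the mixed one; [pf] is the curve of fixed points, and the graph
    [nu = nup p] is the zero set of the reduced function.  [touch] records that
    the reduced function on the curve of fixed points is the slope [Gp], and
    [dnup0] what the derivative of [G (nup p) p = 0] says where [dnup p = 0]. *)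
Section pitchfork.
Context {R : realType} (J : set R) (a b : R).
Context (G Gp Gpp Gppp Gnp : R -> R -> R) (pf dpf nup dnup : R -> R).
Hypothesis iJ : is_interval J.
Hypothesis dG : forall nu p, J nu -> a < p < b -> is_derive p 1 (G nu) (Gp nu p).
Hypothesis dGp : forall nu p, J nu -> a < p < b -> is_derive p 1 (Gp nu) (Gpp nu p).
Hypothesis dGpp : forall nu p, J nu -> a < p < b -> is_derive p 1 (Gpp nu) (Gppp nu p).
Hypothesis cGpp : forall nu p, J nu -> a < p < b ->
  {for (nu, p), continuous (fun z : R * R => Gpp z.1 z.2)}.
Hypothesis sgn : forall nu p nu' p', J nu -> a < p < b -> J nu' -> a < p' < b ->
  Gppp nu p * Gnp nu' p' < 0.
Hypothesis transversal : forall nu p nu' p' nu'', J nu -> a < p < b ->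
  J nu' -> a < p' < b -> J nu'' -> Gnp nu p + Gpp nu' p' * dpf nu'' != 0.
Hypothesis pf_ab : forall nu, J nu -> a < pf nu < b.
Hypothesis pf_cont : forall nu, J nu -> {for nu, continuous pf}.
Hypothesis Gpf : forall nu, J nu -> G nu (pf nu) = 0.
Hypothesis dslope : forall nu, J nu ->
  is_derive nu 1 (fun n => Gp n (pf n)) (Gnp nu (pf nu) + Gpp nu (pf nu) * dpf nu).
Hypothesis ab : a <= b.
Hypothesis nupJ : forall p, a <= p <= b -> J (nup p).
Hypothesis nup_cont : forall p, a <= p <= b -> {for p, continuous nup}.
Hypothesis Gnup : forall p, a < p < b -> G (nup p) p = 0.
Hypothesis touch : forall p, a < p < b -> p = pf (nup p) -> Gp (nup p) p = 0.
Hypothesis dnup0 : forall p, a < p < b -> dnup p = 0 -> Gp (nup p) p = 0.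

Let slope nu := Gp nu (pf nu).

Let nupJ' p : a < p < b -> J (nup p).
Proof. by move=> ?; apply: nupJ; lra. Qed.

Lemma slope_inj x y : J x -> J y -> slope x = slope y -> x = y.
Proof.
suff H u v : J u -> J v -> u < v -> slope u <> slope v.
  move=> Jx Jy e; case: (ltgtP x y) => // xy; first by have := H _ _ Jx Jy xy.
  by have := H _ _ Jy Jx xy; rewrite e.
move=> Ju Jv uv e.
have iuv t : u <= t <= v -> J t by exact: iJ.
have [c /andP[uc cv]] := MVT_oo uv (fun t h => dslope (iuv t h)).
rewrite -/(slope u) -/(slope v) e subrr => /esym/eqP.
have Jc : J c by apply: iuv; lra.
rewrite mulf_eq0 (negbTE (transversal Jc (pf_ab Jc) Jc (pf_ab Jc) Jc)) /=.
by lra.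
Qed.

Let gap p := p - pf (nup p).

Let gap_cont p : a <= p <= b -> {for p, continuous gap}.
Proof.
move=> pab; apply: continuousB; first exact: cvg_id.
by apply: continuous_comp; [exact: nup_cont|apply/pf_cont/nupJ].
Qed.

(** [p - pf (nup p)] is negative at [a] and positive at [b], because [pf] stays
    strictly inside the interval. *)
Lemma crossing_exists : exists2 p, a < p < b & p = pf (nup p).
Proof.
have [||p pab /eqP] := @IVT_zero _ gap a b ab.
- exact: gap_cont.
- have Ja : J (nup a) by apply: nupJ; rewrite lexx ab.
  have Jb : J (nup b) by apply: nupJ; rewrite lexx ab.
  have := pf_ab Ja; have := pf_ab Jb; move=> /andP[? ?] /andP[? ?]; apply: mulr_le0_ge0; rewrite /gap; lra.
rewrite subr_eq0 => /eqP e; exists p => //; rewrite e; exact/pf_ab/nupJ.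
Qed.

(** At a crossing the slope along the curve of fixed points vanishes, and an
    injective function has at most one zero. *)
Lemma crossing_unique p q : a < p < b -> a < q < b ->
  p = pf (nup p) -> q = pf (nup q) -> p = q.
Proof.
move=> pab qab ep eq; suff : nup p = nup q by move=> e; rewrite ep e -eq.
apply: slope_inj; try exact: nupJ'.
by rewrite /slope -ep -eq !touch.
Qed.

Variable p0 : R.
Hypothesis p0_ab : a < p0 < b.
Hypothesis p0_cross : p0 = pf (nup p0).

Let nu0 := nup p0.
Let J0 : J nu0. Proof. exact: nupJ'. Qed.

(** Another sign of [p - pf (nup p)] would create a second crossing.  This is
    what places the fixed point between [p] and its partner. *)
Lemma gap_sign p : a < p < b -> (p < p0 -> p < pf (nup p)) /\ (p0 < p -> pf (nup p) < p).
Proof.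
move=> pab; split=> pp0; rewrite ltNge; apply/negP => h.
- have ap : a <= p by lra.
  have [||c /andP[ac cp] /eqP] := @IVT_zero _ gap a p ap.
  + by move=> t /andP[? ?]; apply: gap_cont; lra.
  + have Ja : J (nup a) by apply: nupJ; lra.
    by have := pf_ab Ja; move=> /andP[? ?]; apply: mulr_le0_ge0; rewrite /gap; lra.
  rewrite subr_eq0 => /eqP e.
  have cab : a < c < b by rewrite e; apply/pf_ab/nupJ; lra.
  by have := crossing_unique cab p0_ab e p0_cross; lra.
- have pb : p <= b by lra.
  have [||c /andP[pc cb] /eqP] := @IVT_zero _ gap p b pb.
  + by move=> t /andP[? ?]; apply: gap_cont; lra.
  + have Jb : J (nup b) by apply: nupJ; lra.
    by have := pf_ab Jb; move=> /andP[? ?]; apply: mulr_le0_ge0; rewrite /gap; lra.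
  rewrite subr_eq0 => /eqP e.
  have cab : a < c < b by rewrite e; apply/pf_ab/nupJ; lra.
  by have := crossing_unique cab p0_ab e p0_cross; lra.
Qed.

(** [s] abstracts the action of the k-th iterate of the map on the curve of
    zeros.  It preserves the parameter, it is an involution, and its fixed points
    are crossings. *)
Variables (s : R -> R) (r0 : R).
Hypothesis r0_gt0 : 0 < r0.
Hypothesis r0_ab : forall p, `|p - p0| < r0 -> a < p < b.
Hypothesis s_cont : forall p, `|p - p0| < r0 -> {for p, continuous s}.
Hypothesis s_ab : forall p, `|p - p0| < r0 -> a < s p < b.
Hypothesis s_nup : forall p, `|p - p0| < r0 -> p <> p0 -> nup (s p) = nup p.
Hypothesis s_fix : forall p, `|p - p0| < r0 -> s p = p -> p = pf (nup p).
Hypothesis s_inv : forall p, `|p - p0| < r0 -> `|s p - p0| < r0 -> s (s p) = p.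
Hypothesis s_p0 : s p0 = p0.

Let s_near e : 0 < e -> exists2 d, 0 < d <= r0 & forall p, `|p - p0| < d -> `|s p - p0| < e.
Proof.
move=> e0; have d0 : `|p0 - p0| < r0 by rewrite subrr normr0.
have : \forall p \near p0, `|s p - s p0| < e.
  by have /cvgr_distC_lt := s_cont d0; apply.
move=> /nbhs_ballP[d /= dgt0 h]; exists (Num.min d r0).
  by rewrite lt_min dgt0 r0_gt0/= ge_min lexx orbT.
move=> p; rewrite lt_min => /andP[pd _]; rewrite -[X in _ - X]s_p0.
by apply: h; rewrite /ball/= distrC.
Qed.

(** [s] has no fixed point on either side of [p0], so [involution_escapes]
    applies on both of them. *)
Lemma partner_opposite : exists2 r, 0 < r <= r0 & forall p, `|p - p0| < r ->
  `|s p - p0| < r0 /\ (p < p0 -> p0 < s p) /\ (p0 < p -> s p < p0).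
Proof.
have [r r12 hr] := s_near r0_gt0; exists r => // p pr.
have pr0 : `|p - p0| < r0 by lra.
have sp := hr _ pr; split=> //.
have ss := s_inv pr0 sp.
have nfix q : `|q - p0| < r0 -> q <> p0 -> s q <> q.
  move=> qr qp /(s_fix qr) e; apply: qp.
  exact: (crossing_unique (r0_ab qr) p0_ab).
have sp0 : p <> p0 -> s p <> p0 by move=> + e; rewrite -ss e s_p0.
split=> pp0; rewrite ltNge; apply/negP => h.
- have {}h : s p < p0 by rewrite lt_neqAle h andbT; apply/eqP/sp0; lra.
  apply: (@involution_escapes _ s [set t | p0 - r0 < t < p0] _ _ _ p) => //=.
  + by move=> x y /= /andP[? ?] /andP[? ?] z /andP[? ?]; lra.
  + by move=> x /= ?; apply: s_cont; rewrite ltr_norml; lra.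
  + by move=> x /= ?; apply: nfix; [rewrite ltr_norml; lra|lra].
  + by move: pr0; rewrite ltr_norml; lra.
  + by move: sp; rewrite ltr_norml; lra.
- have {}h : p0 < s p by rewrite lt_neqAle h andbT eq_sym; apply/eqP/sp0; lra.
  apply: (@involution_escapes _ s [set t | p0 < t < p0 + r0] _ _ _ p) => //=.
  + by move=> x y /= /andP[? ?] /andP[? ?] z /andP[? ?]; lra.
  + by move=> x /= ?; apply: s_cont; rewrite ltr_norml; lra.
  + by move=> x /= ?; apply: nfix; [rewrite ltr_norml; lra|lra].
  + by move: pr0; rewrite ltr_norml; lra.
  + by move: sp; rewrite ltr_norml; lra.
Qed.

Let three p q : a < p < b -> a < q < b -> p < p0 -> p0 < q -> nup p = nup q ->
  [/\ p < pf (nup p), pf (nup p) < q, G (nup p) p = 0, G (nup p) (pf (nup p)) = 0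
    & G (nup p) q = 0].
Proof.
move=> pab qab pp0 p0q e; split.
- exact: (gap_sign pab).1.
- by rewrite e; exact: (gap_sign qab).2.
- exact: Gnup.
- exact/Gpf/nupJ'.
- by rewrite e; exact: Gnup.
Qed.

Let Gppp0 nu p : J nu -> a < p < b -> Gppp nu p != 0.
Proof.
move=> Jn pab; apply/eqP => e; have := sgn Jn pab Jn pab.
by rewrite e mul0r ltxx.
Qed.

(** Between [p] and [s p] there is a zero of [Gpp (nup p)]; both end points tend
    to [p0] as [p] does, and [Gpp] is continuous. *)
Lemma Gpp_crossing : Gpp nu0 p0 = 0.
Proof.
apply/eqP/negP => /negP n0.
have c0 : {for (nu0, p0), continuous (fun z : R * R => Gpp z.1 z.2)} by exact: cGpp.
have : \forall z \near (nu0, p0), Gpp z.1 z.2 != 0.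
  by apply: (cvgr_neq0 _ c0).
move=> /nbhs_ballP[e /= e0 he].
have [d d12 hd] := s_near e0.
have [r r12 hr] := partner_opposite.
have p00 : a <= p0 <= b by have := p0_ab; lra.
have : \forall p \near p0, `|nup p - nup p0| < e.
  by have /cvgr_distC_lt := nup_cont p00; apply.
move=> /nbhs_ballP[d' /= d'0 hd'].
pose t := Num.min (Num.min d r) (Num.min d' e) / 2.
have [t0 td tr td' te] : [/\ 0 < t, t < d, t < r, t < d' & t < e].
  have : 0 < Num.min (Num.min d r) (Num.min d' e) by rewrite !lt_min; lra.
  have : Num.min (Num.min d r) (Num.min d' e) <= d by rewrite !ge_min lexx.
  have : Num.min (Num.min d r) (Num.min d' e) <= r by rewrite !ge_min lexx !orbT.
  have : Num.min (Num.min d r) (Num.min d' e) <= d' by rewrite !ge_min lexx !orbT.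
  have : Num.min (Num.min d r) (Num.min d' e) <= e by rewrite !ge_min lexx !orbT.
  by rewrite /t; split; lra.
pose p := p0 - t.
have np : `|p - p0| = t by rewrite /p addrAC subrr add0r normrN gtr0_norm.
have pd : `|p - p0| < d by rewrite np.
have pr : `|p - p0| < r by rewrite np.
have pr0 : `|p - p0| < r0 by lra.
have pp0 : p < p0 by rewrite /p; lra.
have [_ [/(_ pp0) sp0 _]] := hr _ pr.
have sab := s_ab pr0; have pab := r0_ab pr0.
have ns : nup p = nup (s p) by rewrite s_nup//; lra.
have Jp : J (nup p) by exact: nupJ'.
have [h1 h2 z1 z2 z3] := three pab sab pp0 sp0 ns.
have [[c c12 c0'] _] := middle_zero (fun x h => dG Jp h) (fun x h => dGp Jp h)
  (fun x h => dGpp Jp h) (fun x h => Gppp0 Jp h) (proj1 (andP pab)) h1 h2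
  (proj2 (andP sab)) z1 z2 z3.
have := hd _ pd; rewrite ltr_norml => /andP[_ spe].
have : Gpp (nup p) c != 0.
  apply: (he (nup p, c)); split => /=.
    rewrite /ball/= distrC; apply: hd'; rewrite /ball/= distrC np//.
  by rewrite /ball/= ltr_norml; apply/andP; rewrite /p in c12; lra.
by rewrite c0' eqxx.
Qed.

(** Everything comes from the three zeros [p], [pf (nup p)] and [s p] of
    [G (nup p)].  The slope at the middle one tells on which side of [nu0] the
    parameter lies; a second point of the same side with the same parameter, or a
    point of the other side different from [s p], would be a fourth zero; and a
    zero derivative of [nup] would make an outer zero double. *)
Lemma pitchfork_shape : exists2 r, 0 < r < r0 &
  [/\ forall p, `|p - p0| <= r -> p <> p0 -> nu0 < nup p,
      forall p q, p0 - r <= p <= p0 -> p0 - r <= q <= p0 -> nup p = nup q -> p = q,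
      forall p q, p0 <= p <= p0 + r -> p0 <= q <= p0 + r -> nup p = nup q -> p = q,
      forall p, `|p - p0| <= r -> p <> p0 -> dnup p != 0 &
      forall p q, p0 - r <= p < p0 -> p0 < q <= p0 + r -> nup p = nup q ->
        s p = q /\ s q = p].
Proof.
have [r1 r12 hr] := partner_opposite; exists (r1 / 2); first by lra.
set r := r1 / 2.
have rr p : `|p - p0| <= r -> [/\ `|p - p0| < r1, `|p - p0| < r0 & a < p < b].
  move=> h; have h1 : `|p - p0| < r1 by rewrite /r in h; lra.
  have h2 : `|p - p0| < r0 by lra.
  by split => //; exact: r0_ab.
have left p : p0 - r <= p < p0 -> `|p - p0| <= r by rewrite ler_norml; lra.
have right p : p0 < p <= p0 + r -> `|p - p0| <= r by rewrite ler_norml; lra.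
(* By [middle_zero] and [sgn] the slope at [nup p] has the sign of [Gnp], which
   is also the sign of the derivative of the slope at [nu0]. *)
have pos p : `|p - p0| <= r -> p <> p0 -> nu0 < nup p.
  move=> pr pp0; have [p1 p2 pab] := rr _ pr.
  have [_ [hl hrr]] := hr _ p1.
  have sab := s_ab p2; have ns := s_nup p2 pp0.
  have Jp := nupJ' pab.
  have [e e_ab he] : exists2 e, a < e < b & slope (nup p) * Gppp (nup p) e < 0.
    have [/[dup] lt /hl ls|/[dup] lt /hrr ls|//] := ltgtP p p0.
      have [h1 h2 z1 z2 z3] := three pab sab lt ls (esym ns).
      have [_ [e e12 he]] := middle_zero (fun x h => dG Jp h) (fun x h => dGp Jp h)
        (fun x h => dGpp Jp h) (fun x h => Gppp0 Jp h) (proj1 (andP pab)) h1 h2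
        (proj2 (andP sab)) z1 z2 z3.
      by exists e => //; lra.
    have := three sab pab ls lt ns; rewrite ns => -[h1 h2 z1 z2 z3].
    have [_ [e e12 he]] := middle_zero (fun x h => dG Jp h) (fun x h => dGp Jp h)
        (fun x h => dGpp Jp h) (fun x h => Gppp0 Jp h) (proj1 (andP sab)) h1 h2
        (proj2 (andP pab)) z1 z2 z3.
    by exists e => //; lra.
  have k1 := sgn Jp e_ab J0 p0_ab.
  pose d := Gnp nu0 p0.
  have d0 : d != 0.
    by apply/eqP => e0; move: k1; rewrite -/d e0 mulr0 ltxx.
  have sl0 : slope nu0 = 0 by rewrite /slope /nu0 -p0_cross touch.
  have dsl : is_derive nu0 1 slope d.
    have := dslope J0; rewrite -[pf nu0]p0_cross Gpp_crossing mul0r addr0.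
    exact.
  apply: (@positive_right_of_zero _ (fun n => d * slope n) J nu0 (d * d) iJ) => //.
  - move=> x Jx; apply: continuousM; first exact: cst_continuous.
    by apply: is_derive_continuous; exact: dslope.
  - by move=> x y Jx Jy /(mulfI d0); exact: slope_inj.
  - by rewrite sl0 mulr0.
  - by rewrite -expr2 lt_neqAle sqr_ge0 andbT eq_sym sqrf_eq0.
  - have : 0 < (slope (nup p) * d) * Gppp (nup p) e ^+ 2.
      have -> : slope (nup p) * d * Gppp (nup p) e ^+ 2 =
        (slope (nup p) * Gppp (nup p) e) * (Gppp (nup p) e * d) by ring.
      by rewrite nmulr_rgt0.
    rewrite pmulr_lgt0 1?mulrC//.
    by rewrite lt_neqAle sqr_ge0 andbT eq_sym sqrf_eq0; exact: Gppp0.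
(* A second point of the same side with the same parameter is a fourth zero. *)
have noL p q : p0 - r <= p -> p < q -> q < p0 -> nup p <> nup q.
  move=> p1 pq q1 e.
  have pr : `|p - p0| <= r by apply: left; lra.
  have qr : `|q - p0| <= r by apply: left; lra.
  have [pr1 pr2 pab] := rr _ pr; have [qr1 qr2 qab] := rr _ qr.
  have [_ [hl _]] := hr _ qr1; have {}hl := hl q1.
  have sab := s_ab qr2.
  have [h1 h2 z1 z2 z3] := three qab sab q1 hl (esym (s_nup qr2 (elimF eqP (lt_eqF q1)))).
  have z0 : G (nup q) p = 0 by rewrite -e; exact: Gnup.
  have Jq := nupJ' qab.
  exact: (no_four_zeros (fun x h => dG Jq h) (fun x h => dGp Jq h)
        (fun x h => dGpp Jq h) (fun x h => Gppp0 Jq h) (proj1 (andP pab)) pq h1 h2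
        (proj2 (andP sab)) z0 z1 z2 z3).
have noR p q : p0 < p -> p < q -> q <= p0 + r -> nup p <> nup q.
  move=> p1 pq q1 e.
  have pr : `|p - p0| <= r by apply: right; lra.
  have qr : `|q - p0| <= r by apply: right; lra.
  have [pr1 pr2 pab] := rr _ pr; have [qr1 qr2 qab] := rr _ qr.
  have [_ [_ hl]] := hr _ pr1; have {}hl := hl p1.
  have sab := s_ab pr2.
  have pp0 : p <> p0 by lra.
  have := three sab pab hl p1 (s_nup pr2 pp0).
  rewrite (s_nup pr2 pp0) => -[h1 h2 z1 z2 z3].
  have z0 : G (nup p) q = 0 by rewrite e; exact: Gnup.
  have Jq := nupJ' pab.
  exact: (no_four_zeros (fun x h => dG Jq h) (fun x h => dGp Jq h)
        (fun x h => dGpp Jq h) (fun x h => Gppp0 Jq h) (proj1 (andP sab)) h1 h2 pq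
        (proj2 (andP qab)) z1 z2 z3 z0).
have no0 p : `|p - p0| <= r -> p <> p0 -> nup p <> nup p0.
  by move=> pr pp0 e; have := pos p pr pp0; rewrite /nu0 e ltxx.
split => //.
- suff H p q : p0 - r <= p -> p < q -> q <= p0 -> nup p <> nup q.
    move=> p q /andP[? ?] /andP[? ?] e; case: (ltgtP p q) => // pq.
      by have := H p q; rewrite e; tauto.
    by have := H q p; rewrite e; tauto.
  move=> p1 pq; rewrite le_eqVlt => /orP[/eqP q1|]; last exact: noL.
  by rewrite q1; apply: no0; [apply: left; lra|lra].
- suff H p q : p0 <= p -> p < q -> q <= p0 + r -> nup p <> nup q.
    move=> p q /andP[? ?] /andP[? ?] e; case: (ltgtP p q) => // pq.
      by have := H p q; rewrite e; tauto.
    by have := H q p; rewrite e; tauto.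
  rewrite le_eqVlt => /orP[/eqP q1|]; last exact: noR.
  move=> pq qr; rewrite -q1 => /esym; apply: no0; [apply: right; lra|lra].
- move=> p pr pp0; apply/eqP => /dnup0 G0.
  have [p1 p2 pab] := rr _ pr; have {}G0 := G0 pab.
  have [_ [hl hrr]] := hr _ p1.
  have sab := s_ab p2; have ns := s_nup p2 pp0.
  have Jp := nupJ' pab.
  have [/[dup] lt /hl ls|/[dup] lt /hrr ls|//] := ltgtP p p0.
    have [h1 h2 z1 z2 z3] := three pab sab lt ls (esym ns).
    have [] := simple_outer_zeros (fun x h => dG Jp h) (fun x h => dGp Jp h)
        (fun x h => dGpp Jp h) (fun x h => Gppp0 Jp h) (proj1 (andP pab)) h1 h2
        (proj2 (andP sab)) z1 z2 z3.
    by rewrite G0 eqxx.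
  have := three sab pab ls lt ns; rewrite ns => -[h1 h2 z1 z2 z3].
  have [_] := simple_outer_zeros (fun x h => dG Jp h) (fun x h => dGp Jp h)
        (fun x h => dGpp Jp h) (fun x h => Gppp0 Jp h) (proj1 (andP sab)) h1 h2
        (proj2 (andP pab)) z1 z2 z3.
  by rewrite G0 eqxx.
- move=> p q /andP[lp p1] /andP[q1 rq] e.
  have pr : `|p - p0| <= r by apply: left; lra.
  have qr : `|q - p0| <= r by apply: right; lra.
  have [pr1 pr2 pab] := rr _ pr; have [qr1 qr2 qab] := rr _ qr.
  have [spr [/(_ p1) hs _]] := hr _ pr1; have sab := s_ab pr2.
  have ns : nup (s p) = nup p by apply: s_nup => //; lra.
  suff sq : s p = q by split=> //; rewrite -sq; exact: s_inv.
  have Jp := nupJ' pab.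
  have [h1 h2 z1 z2 z3] := three pab qab p1 q1 e.
  have [h1' h2' _ _ z3'] := three pab sab p1 hs (esym ns).
  case: (ltgtP (s p) q) => // lt; exfalso.
    exact: (no_four_zeros (fun x h => dG Jp h) (fun x h => dGp Jp h)
        (fun x h => dGpp Jp h) (fun x h => Gppp0 Jp h) (proj1 (andP pab)) h1 h2' lt
        (proj2 (andP qab)) z1 z2 z3' z3).
  exact: (no_four_zeros (fun x h => dG Jp h) (fun x h => dGp Jp h)
        (fun x h => dGpp Jp h) (fun x h => Gppp0 Jp h) (proj1 (andP pab)) h1 h2 lt
        (proj2 (andP sab)) z1 z2 z3 z3').
Qed.

End pitchfork.

(** * Inverse branches of a function with a fold *)
Section inverse_branches.
Context {R : realType}.

Lemma increasing_branch (n : R -> R) (u v : R) : u < v ->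
  (forall x, u <= x <= v -> {for x, continuous n}) ->
  (forall x y, u <= x <= v -> u <= y <= v -> n x = n y -> x = y) -> n u < n v ->
  exists h : R -> R,
  [/\ forall y, n u <= y <= n v -> u <= h y <= v /\ n (h y) = y,
      forall x, u <= x <= v -> n u <= n x <= n v,
      forall x, u <= x <= v -> h (n x) = x &
      {within `[n u, n v], continuous h}].
Proof.
move=> uv cn inj nuv.
have wn : {within `[u, v], continuous n} by exact: within_for_continuous.
have uv' := ltW uv; have nuv' := ltW nuv.
pose h y := get [set x | u <= x <= v /\ n x = y].
have hK x : u <= x <= v -> h (n x) = x.
  move=> xuv; have [hx he] : [set y | u <= y <= v /\ n y = n x] (h (n x)).
    by apply: getPex; exists x.
  exact: inj.
have hK' : {in `[u, v], cancel n h} by move=> x; rewrite in_itv/=; exact: hK.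
have inj' : {in `[u, v] &, injective n}.
  by move=> x y; rewrite !in_itv/=; exact: inj.
have mono := segment_continuous_inj_le nuv' wn inj'.
exists h; split.
- move=> y ynn; have [|x] := @IVT R n u v y uv' wn.
    by rewrite (min_idPl nuv') (max_idPr nuv').
  by rewrite in_itv/= => xuv <-; rewrite hK.
- move=> x xuv; have xi : x \in `[u, v] by rewrite in_itv.
  have ui : u \in `[u, v] by rewrite in_itv/= lexx.
  have vi : v \in `[u, v] by rewrite in_itv/= lexx andbT.
  by rewrite !mono.
- exact: hK.
- exact: segment_can_le_continuous.
Qed.

Lemma decreasing_branch (n : R -> R) (u v : R) : u < v ->
  (forall x, u <= x <= v -> {for x, continuous n}) ->
  (forall x y, u <= x <= v -> u <= y <= v -> n x = n y -> x = y) -> n v < n u ->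
  exists h : R -> R,
  [/\ forall y, n v <= y <= n u -> u <= h y <= v /\ n (h y) = y,
      forall x, u <= x <= v -> n v <= n x <= n u,
      forall x, u <= x <= v -> h (n x) = x &
      {within `[n v, n u], continuous h}].
Proof.
move=> uv cn inj nuv.
have [||||h [h1 h2 h3 h4]] := @increasing_branch (n \o -%R) (- v) (- u).
- by rewrite ltrN2.
- move=> x xuv; apply: continuous_comp; first exact: opp_continuous.
  by apply: cn; lra.
- move=> x y xuv yuv /= e; apply: oppr_inj; apply: inj => //; lra.
- by rewrite /= !opprK.
rewrite /= !opprK in h1 h2 h4.
exists (fun y => - h y); split.
- by move=> y /h1[? ?]; split => //; lra.
- by move=> x xuv; rewrite -(opprK x); apply: h2; lra.
- by move=> x xuv; have := h3 (- x); rewrite /= opprK => ->; rewrite ?opprK//; lra.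
- by move=> x; apply: continuousN; exact: h4.
Qed.

End inverse_branches.

(** * Partial derivatives and the reduced bifurcation function *)
Lemma open_setX (T U : topologicalType) (A : set T) (B : set U) :
  open A -> open B -> open (A `*` B).
Proof.
move=> oA oB; rewrite openE => -[x y] [/= Ax By].
by exists (A, B) => //; split; apply: open_nbhs_nbhs.
Qed.

Section partial_derivatives.
Context {R : realType}.

(** At an interior point of [A] all small increments are admissible, so the
    restricted filter is the punctured neighbourhood filter of 0. *)
Lemma derive_in_interior (A : set R) (h : R -> R) (x d : R) : A° x ->
  is_derive x 1 h d -> derive_in A h x = d.
Proof.
move=> Ax dh; rewrite /derive_in.
have nA : \forall t \near 0^', A (x + t).
  have : (fun t : R => x + t) @ (0 : R) --> x + 0.
    by apply: cvgD; [exact: cvg_cst|exact: cvg_id].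
  by rewrite addr0 => /(_ _ Ax) /= h0; apply: nbhs_dnbhs.
have -> : within [set t | A (x + t)] 0^' = 0^' :> set (set R).
  apply/seteqP; split=> P /=; rewrite /within/=.
    by move=> h1; apply: filterS2 nA h1 => t At h2; exact: h2 At.
  by apply: filterS => t Pt _.
apply: cvg_lim => //.
have [dv <-] := dh; rewrite /derive.
have -> : (fun t => t^-1 * (h (x + t) - h x)) =
  (fun t => t^-1 *: ((h \o shift x) (t *: (1 : R)) - h x)).
  by apply/funext => t /=; rewrite /GRing.scale/= mulr1 (addrC x).
exact: dv.
Qed.

Lemma is_derive_comp_pair (f : R * R -> R) (u v : R -> R) (t du dv : R) :
  differentiable f (u t, v t) -> is_derive t 1 u du -> is_derive t 1 v dv ->
  is_derive t 1 (fun s => f (u s, v s))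
    (du * 'd f (u t, v t) (1, 0) + dv * 'd f (u t, v t) (0, 1)).
Proof.
move=> df [eu <-] [ev <-].
have du' : differentiable u t by exact/derivable1_diffP.
have dv' : differentiable v t by exact/derivable1_diffP.
have dp := differentiable_pair du' dv'.
have dfp : differentiable (f \o (fun s => (u s, v s))) t by exact: differentiable_comp.
have dd : derivable (f \o (fun s => (u s, v s))) t 1 by exact: diff_derivable.
apply: DeriveDef; first exact: dd.
rewrite !deriveE//.
have -> : 'd (f \o (fun s => (u s, v s))) t 1 = 'd f (u t, v t) ('d u t 1, 'd v t 1).
  have e1 := congr1 (fun h : R -> R => h 1) (diff_comp dp df).
  have e2 := congr1 (fun h : R -> R * R => h 1) (diff_pair du' dv').
  by rewrite e1 /= e2.
move: ('d u t 1) ('d v t 1) => x y.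
have -> : (x, y) = x *: ((1, 0) : R * R) + y *: ((0, 1) : R * R).
  by congr pair; rewrite /= /GRing.scale/= ?mulr1 ?mulr0 ?addr0 ?add0r.
by rewrite linearD !linearZ.
Qed.

Context (J P1 : set R) (oJ : open J).
Let D : set (R * R) := J `*` P1°.

Lemma open_rect : open D.
Proof. by apply: open_setX => //; exact: open_interior. Qed.

Lemma dp_is_derive (G : R -> R -> R) nu p : differentiable (fun z => G z.1 z.2) (nu, p) ->
  P1° p ->
  is_derive p 1 (G nu) ('d (fun z => G z.1 z.2) (nu, p) (0, 1)) /\
  dp P1 G nu p = 'd (fun z => G z.1 z.2) (nu, p) (0, 1).
Proof.
move=> dG Pp.
have h : is_derive p 1 (G nu) ('d (fun z => G z.1 z.2) (nu, p) (0, 1)).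
  have := @is_derive_comp_pair (fun z => G z.1 z.2) (fun=> nu) id p 0 1 dG (is_derive_cst _ _ _)
    (is_derive_id _ _).
  by rewrite /= mul0r add0r mul1r.
by split=> //; exact: derive_in_interior.
Qed.

Lemma dp_Cr r (G : R -> R -> R) : Cr r.+1 D (fun z => G z.1 z.2) ->
  Cr r D (fun z => dp P1 G z.1 z.2) /\
  forall nu p, D (nu, p) -> is_derive p 1 (G nu) (dp P1 G nu p).
Proof.
move=> [G1 G2]; split.
  apply: (Cr_ext open_rect _ (G2 (0, 1))) => -[nu p] Dz.
  by have [_ ->] := dp_is_derive (G1 _ Dz) Dz.2.
move=> nu p Dz; have [h ->] := dp_is_derive (G1 _ Dz) Dz.2.
exact: h.
Qed.

(** The total derivative along the curve [nu |-> (nu, q nu)]; its value is the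
    expression which the transversality condition keeps away from 0. *)
Lemma is_derive_dp_along (G : R -> R -> R) (q : R -> R) nu dq :
  differentiable (fun z => dp P1 G z.1 z.2) (nu, q nu) -> P1° (q nu) ->
  is_derive nu 1 q dq ->
  is_derive nu 1 (fun n => dp P1 G n (q n))
    (dnup P1 G nu (q nu) + dpp P1 G nu (q nu) * dq).
Proof.
move=> dG Pq hq.
have := @is_derive_comp_pair (fun z => dp P1 G z.1 z.2) id q nu 1 dq dG (is_derive_id _ _) hq.
rewrite /= mul1r.
have -> : dpp P1 G nu (q nu) = 'd (fun z => dp P1 G z.1 z.2) (nu, q nu) (0, 1).
  by have [_ <-] := dp_is_derive dG Pq.
suff -> : dnup P1 G nu (q nu) = 'd (fun z => dp P1 G z.1 z.2) (nu, q nu) (1, 0).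
  by rewrite (mulrC dq).
have := @is_derive_comp_pair (fun z => dp P1 G z.1 z.2) id (fun=> q nu) nu 1 0 dG (is_derive_id _ _)
  (is_derive_cst _ _ _).
rewrite /= mul1r mul0r addr0 => -[_ <-].
by rewrite /dnup derive1E.
Qed.

(** The integrand times [p - q] is the derivative of
    [t |-> F (t * (p - q) + q)].  Applied to [F = G nu] and [q] on the curve of
    fixed points, this factors [G] through the reduced bifurcation function. *)
Lemma hadamard_quotient (F F1 : R -> R) (a b p q : R) :
  (forall x, a < x < b -> is_derive x 1 F (F1 x)) ->
  (forall x, a < x < b -> {for x, continuous F1}) ->
  a < p < b -> a < q < b ->
  (p - q) * (\int[lebesgue_measure]_(t in `[0, 1]) F1 (t * (p - q) + q)) = F p - F q.
Proof.
move=> dF cF pab qab.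
have tab (t : R) : 0 <= t <= 1 -> a < t * (p - q) + q < b.
  move=> /andP[t0 t1]; have [pq|qp] := leP p q.
    have h1 : p - q <= t * (p - q) by nra.
    have h2 : t * (p - q) <= 0 by nra.
    lra.
  have h1 : t * (p - q) <= p - q by nra.
  have h2 : 0 <= t * (p - q) by nra.
  lra.
pose f t := (p - q) * F1 (t * (p - q) + q).
have aff (t : R) : is_derive t 1 (fun t : R => t * (p - q) + q) (p - q).
  apply/is_derive1_caratheodory; exists (cst (p - q)); split => //.
    by move=> z /=; ring.
  exact: cst_continuous.
have caff : continuous (fun t : R => t * (p - q) + q).
  by move=> t; exact: is_derive_continuous (aff t).
have cf1 (t : R) : 0 <= t <= 1 -> {for t, continuous (fun t : R => F1 (t * (p - q) + q))}.
  by move=> t01; apply: continuous_comp; [exact: caff|exact/cF/tab].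
have cf (t : R) : 0 <= t <= 1 -> {for t, continuous f}.
  by move=> t01; apply: continuousM; [exact: cst_continuous|exact: cf1].
have df (t : R) : 0 <= t <= 1 -> is_derive t 1 (fun t : R => F (t * (p - q) + q)) (f t).
  by move=> t01; rewrite /f mulrC; apply: (@is_derive1_comp _ F (fun t : R => t * (p - q) + q)); exact/dF/tab.
have -> : (p - q) * (\int[lebesgue_measure]_(t in `[0, 1]) F1 (t * (p - q) + q)) =
  \int[lebesgue_measure]_(t in `[0, 1]) f t.
  rewrite RintegralZl//.
  apply: continuous_compact_integrable; first exact: segment_compact.
  by apply: within_for_continuous => t; exact: cf1.
rewrite /Rintegral.
rewrite (@continuous_FTC2 _ f (fun t : R => F (t * (p - q) + q)) 0 1)//.
- by rewrite -EFinB /= mul1r mul0r add0r subrK.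
- by apply: within_for_continuous.
- have cFt (t : R) : 0 <= t <= 1 -> {for t, continuous (fun t : R => F (t * (p - q) + q))}.
    by move=> /df/is_derive_continuous.
  split.
  + move=> t; rewrite in_itv/= => t01.
    have t01' : 0 <= t <= 1 by lra.
    by have [] := df t t01'.
  + by apply: cvg_at_right_filter; apply: cFt; rewrite lexx ler01.
  + by apply: cvg_at_left_filter; apply: cFt; rewrite lexx ler01.
- move=> t; rewrite in_itv/= => t01; rewrite derive1E.
  have t01' : 0 <= t <= 1 by lra.
  by have [_ ->] := df t t01'.
Qed.

Lemma hadamard_quotient_diag (F1 : R -> R) (p : R) :
  \int[lebesgue_measure]_(t in `[0, 1]) F1 (t * (p - p) + p) = F1 p.
Proof.
rewrite (_ : (fun t => _) = fun=> F1 p); last first.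
  by apply/funext => t; rewrite subrr mulr0 add0r.
rewrite Rintegral_cst//= lebesgue_measure_itv/= lte_fin ltr01.
by rewrite sube0 mulr1.
Qed.

End partial_derivatives.

(** * C^r maps into a manifold *)
Lemma open_setI_preimage (T U : topologicalType) (D : set T) (h : T -> U) (O : set U) :
  open D -> (forall z, D z -> {for z, continuous h}) -> open O ->
  open (D `&` h @^-1` O).
Proof.
move=> oD ch oO; rewrite openE => z [Dz Oz]; apply: filterI.
  exact: open_nbhs_nbhs.
by apply: (ch z Dz); exact: open_nbhs_nbhs.
Qed.

Lemma near_eq_for_continuous (T U : topologicalType) (h g : T -> U) (z : T) :
  {near z, h =1 g} -> {for z, continuous h} -> {for z, continuous g}.
Proof.
move=> hg ch; rewrite /prop_for /continuous_at -(nbhs_singleton hg).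
by apply: cvg_trans ch; apply: near_eq_cvg; apply: filterS hg.
Qed.

Lemma continuous_at_pair (T U V : topologicalType) (f : T -> U) (g : T -> V) (z : T) :
  {for z, continuous f} -> {for z, continuous g} ->
  {for z, continuous (fun x => (f x, g x))}.
Proof. by move=> cf cg; exact: (cvg_pair cf cg). Qed.

Section manifold_calculus.
Context {R : realType} {X : topologicalType} {E : normedModType R}.
Context (S : smooth_structure X E) (fE : finite_frame E).
Implicit Types W : normedModType R.

Lemma Cr_into_cont r W (D : set W) (h : W -> X) z :
  Cr_into S r D h -> D z -> {for z, continuous h}.
Proof. by move=> [c _]; exact: c. Qed.

Lemma Cr_into_sub r W (D D' : set W) (h : W -> X) :
  D' `<=` D -> Cr_into S r D h -> Cr_into S r D' h.
Proof.
move=> DD [h1 h2]; split=> [z /DD|c Sc]; first exact: h1.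
by apply: Cr_sub (h2 c Sc) => z [/DD].
Qed.

(** [Cr_into] only tests the charts of the atlas [S]; another chart of the
    maximal atlas is reached through transition maps. *)
Lemma Cr_into_fwd r W (D : set W) (h : W -> X) (c : chart X E) : open D ->
  local_coordinates S c -> Cr_into S r D h ->
  Cr r (D `&` h @^-1` cdom c) (cfwd c \o h).
Proof.
move=> oD lc [h1 h2]; apply: Cr_local => z [Dz cz].
have [c' Sc' c'z] := atlas_cover S (h z).
have [_ tr] := lc _ Sc'.
pose D' := (D `&` h @^-1` cdom c') `&` (h @^-1` cdom c).
exists D'; first by split.
have oDc' : open (D `&` h @^-1` cdom c').
  by apply: open_setI_preimage => //; exact: cdom_open.
have oD' : open D'.
  apply: open_setI_preimage => //; last exact: cdom_open.
  by move=> x [/h1].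
have hc' : Cr r D' (cfwd c' \o h) by apply: Cr_sub (h2 _ Sc') => x [].
have sub x : D' x -> (ccod c' `&` cbwd c' @^-1` cdom c) ((cfwd c' \o h) x).
  move=> [[Dx c'x] cx]; split; first exact: cfwd_in.
  by rewrite /= cfwdK.
apply: (Cr_ext oD' _ (Cr_comp fE oD' sub hc' (tr r))) => x [[Dx c'x] cx] /=.
by rewrite cfwdK.
Qed.

Lemma Cr_into_bwd r W (D : set W) (v : W -> E) (c : chart X E) : open D ->
  local_coordinates S c -> Cr r D v -> (forall z, D z -> ccod c (v z)) ->
  Cr_into S r D (cbwd c \o v).
Proof.
move=> oD lc hv vc.
have cv z : D z -> {for z, continuous (cbwd c \o v)}.
  move=> Dz; apply: continuous_comp; first exact: Cr_cont hv Dz.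
  exact/cbwd_cont/vc.
split=> // c' Sc'; have [tr _] := lc _ Sc'.
have oD' : open (D `&` (cbwd c \o v) @^-1` cdom c').
  by apply: open_setI_preimage => //; exact: cdom_open.
apply: (Cr_comp fE oD' _ (Cr_sub _ hv) (tr r)) => [z [Dz c'z]|z []//].
by split => //; exact: vc.
Qed.

(** Near each point [u] runs inside one chart of the atlas, where
    [(nu, x) |-> f nu x] becomes a map between normed spaces and [Cr_comp]
    applies. *)
Lemma Cr_into_family r W (M : set (R * X)) (f : R -> X -> X) (D : set W)
    (t : W -> R) (u : W -> X) :
  Cr_family S r M f -> open D -> Cr r D t -> Cr_into S r D u ->
  (forall z, D z -> M (t z, u z)) -> Cr_into S r D (fun z => f (t z) (u z)).
Proof.
move=> fM oD ht hu MD; have [u1 u2] := hu.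
have local c : atlas S c -> forall z, D z -> cdom c (u z) ->
    [/\ open (D `&` u @^-1` cdom c),
        Cr r (D `&` u @^-1` cdom c) (fun x => (t x, cfwd c (u x))) &
        forall x, (D `&` u @^-1` cdom c) x ->
          [set z : R * E | ccod c z.2 /\ M (z.1, cbwd c z.2)] (t x, cfwd c (u x))].
  move=> Sc z Dz cz.
  have oD' : open (D `&` u @^-1` cdom c).
    by apply: open_setI_preimage => //; exact: cdom_open.
  split=> //.
    by apply: Cr_pair => //; [apply: Cr_sub ht => x []|exact: u2].
  move=> x [Dx cx] /=; split; first exact: cfwd_in.
  by rewrite cfwdK//; exact: MD.
have cf z : D z -> {for z, continuous (fun z => f (t z) (u z))}.
  move=> Dz; have [c Sc cz] := atlas_cover S (u z).
  have [oD' hp hM] := local c Sc z Dz cz.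
  have Dz' : (D `&` u @^-1` cdom c) z by split.
  apply: (@near_eq_for_continuous _ _
     ((fun w : R * E => f w.1 (cbwd c w.2)) \o (fun x => (t x, cfwd c (u x))))).
    have : \forall x \near z, (D `&` u @^-1` cdom c) x by exact: open_nbhs_nbhs.
    by apply: filterS => x [Dx cx] /=; rewrite cfwdK.
  apply: continuous_comp; first exact: (Cr_cont hp Dz').
  by have [+ _] := fM c Sc; apply; exact: hM.
split=> // c' Sc'.
have oDc' : open (D `&` (fun z => f (t z) (u z)) @^-1` cdom c').
  by apply: open_setI_preimage => //; exact: cdom_open.
apply: Cr_local => z [Dz c'z].
have [c Sc cz] := atlas_cover S (u z).
have [oD' hp hM] := local c Sc z Dz cz.
pose D'' := (D `&` u @^-1` cdom c) `&` ((fun z => f (t z) (u z)) @^-1` cdom c').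
exists D''; first by split.
have oD'' : open D''.
  apply: open_setI_preimage => //; last exact: cdom_open.
  by move=> x [Dx _]; exact: cf.
have hp' : Cr r D'' (fun x => (t x, cfwd c (u x))) by apply: Cr_sub hp => x [].
have [_ /(_ _ Sc') F2] := fM c Sc.
have frame := finite_frame_prod (finite_frame_R (R := R)) fE.
have sub x : D'' x -> ([set z : R * E | ccod c z.2 /\ M (z.1, cbwd c z.2)]
    `&` (fun z : R * E => f z.1 (cbwd c z.2)) @^-1` cdom c') (t x, cfwd c (u x)).
  move=> [[Dx cx] c'x]; split; first by apply: hM.
  by rewrite /= cfwdK.
by apply: (Cr_ext oD'' _ (Cr_comp frame oD'' sub hp' F2)) => x [[Dx cx] c'x] /=; rewrite cfwdK.
Qed.

Lemma Cr_into_iter r W (M : set (R * X)) (f : R -> X -> X) (D : set W)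
    (t : W -> R) (u : W -> X) j :
  Cr_family S r M f -> open D -> Cr r D t -> Cr_into S r D u ->
  (forall z, D z -> iter_dom M f j (t z, u z)) ->
  Cr_into S r D (fun z => iter j (f (t z)) (u z)).
Proof.
move=> fM oD ht hu; elim: j => [|j IH] MD //=.
apply: (Cr_into_family fM oD ht) => [|z /MD]; last by apply; exact: ltnSn.
by apply: IH => z /MD h i ij; apply: h; exact: ltnW.
Qed.

Lemma family_cont r (M : set (R * X)) (f : R -> X -> X) : open M ->
  Cr_family S r M f ->
  forall z, M z -> {for z, continuous (fun z : R * X => f z.1 z.2)}.
Proof.
move=> oM fM [nu x] Mz; have [c Sc cx] := atlas_cover S x.
apply: (@near_eq_for_continuous _ _
  ((fun w : R * E => f w.1 (cbwd c w.2)) \o (fun z : R * X => (z.1, cfwd c z.2)))).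
  have : \forall z \near (nu, x), cdom c z.2.
    by apply: (@cvg_snd _ _ (nbhs nu) (nbhs x)); apply: open_nbhs_nbhs; split => //; exact: cdom_open.
  by apply: filterS => z cz /=; rewrite cfwdK.
apply: continuous_comp.
  apply: continuous_at_pair; first exact: cvg_fst.
  by apply: (@continuous_comp _ _ _ snd (cfwd c)); [exact: cvg_snd|exact: cfwd_cont].
have [+ _] := fM c Sc; apply; split => /=; first exact: cfwd_in.
by rewrite cfwdK.
Qed.

Lemma open_iter_dom2 r (M : set (R * X)) (f : R -> X -> X) : open M ->
  Cr_family S r M f -> open (iter_dom M f 2).
Proof.
move=> oM fM; have -> : iter_dom M f 2 = M `&` (fun z => (z.1, f z.1 z.2)) @^-1` M.
  apply/seteqP; split=> [z h|z [h0 h1] [|[|//]] _]; last 2 first.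
  - by case: z h0 {h1}.
  - exact: h1.
  by split; [have := h 0%N isT; case: z {h}|exact: (h 1%N isT)].
apply: open_setI_preimage => // z Mz.
apply: continuous_at_pair; first exact: cvg_fst.
exact: (family_cont oM fM Mz).
Qed.

End manifold_calculus.

(** * Symmetric orbits of a reversible map *)
Section reversible_iterates.
Context {X : Type} (N : set X) (F rho : X -> X).
Hypothesis rev : forall x, N x -> F (rho (F x)) = rho x.
Hypothesis revN : forall x, N x -> N (rho (F x)).
Hypothesis injF : forall x y, N x -> N y -> F x = F y -> x = y.

(** [F (rho (F x)) = rho x] says that [rho] conjugates [F] to its inverse: going
    forward from the reflected end point retraces the orbit backwards. *)
Lemma reversed_orbit n x : (forall i, (i < n)%N -> N (iter i F x)) ->
  forall j, (j <= n)%N ->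
  iter j F (rho (iter n F x)) = rho (iter (n - j) F x) /\
  forall i, (i < j)%N -> N (iter i F (rho (iter n F x))).
Proof.
move=> Nx; elim=> [|j IH] jn; first by rewrite subn0.
have [e NN] := IH (ltnW jn).
have nj : (n - j = (n - j.+1).+1)%N by rewrite subnSK.
have Nj : N (iter (n - j.+1) F x) by apply: Nx; rewrite ltn_subrL (leq_ltn_trans _ jn).
split; first by rewrite iterS e nj iterS rev.
move=> i; rewrite ltnS leq_eqVlt => /orP[/eqP ->|]; last exact: NN.
by rewrite e nj iterS; exact: revN.
Qed.

Lemma symmetric_periodic k x : (forall i, (i < k)%N -> N (iter i F x)) ->
  rho x = x -> rho (iter k F x) = iter k F x -> iter k F (iter k F x) = x.
Proof.
move=> Nx rx rk; have [+ _] := reversed_orbit Nx (leqnn k).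
by rewrite subnn rk /= rx.
Qed.

Lemma iter_inj_on k x y : (forall i, (i < k)%N -> N (iter i F x)) ->
  (forall i, (i < k)%N -> N (iter i F y)) -> iter k F x = iter k F y -> x = y.
Proof.
elim: k => [|k IH] Nx Ny //= e.
apply: IH => [i ik|i ik|]; [exact/Nx/ltnW|exact/Ny/ltnW|].
by apply: injF => //; [exact: Nx|exact: Ny].
Qed.

(** With [y = iter k F x], both [y] and [rho y] are mapped to [x] by [iter k F],
    which is injective along these orbits. *)
Lemma periodic_symmetric k x : (forall i, (i < 2 * k)%N -> N (iter i F x)) ->
  rho x = x -> iter k F (iter k F x) = x -> rho (iter k F x) = iter k F x.
Proof.
move=> Nx rx e; have Nk i : (i < k)%N -> N (iter i F x).
  by move=> ik; apply: Nx; rewrite mul2n -addnn ltn_addr.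
have [+ Nr] := reversed_orbit Nk (leqnn k); rewrite subnn /= rx => e2.
apply: (iter_inj_on Nr) => [i ik|]; last by rewrite e2.
by rewrite -iterD; apply: Nx; rewrite mul2n -addnn ltn_add2r.
Qed.

End reversible_iterates.

(** * The coordinates (p1, p2, q1, q2) *)
Section coordinates.
Context {R : realType} {m : nat}.
Notation E := 'rV[R]_((1 + m) + (1 + m)).

Lemma pi_p1_pvec p y : pi_p1 (pvec p y : E) = p.
Proof. by rewrite /pi_p1 /pi_p /pvec !row_mxKl mxE eqxx. Qed.

Lemma pi_p2_pvec p y : pi_p2 (pvec p y : E) = y.
Proof. by rewrite /pi_p2 /pi_p /pvec row_mxKl row_mxKr. Qed.

Lemma pi_q_pvec p y : pi_q (pvec p y : E) = 0.
Proof. by rewrite /pi_q /pvec row_mxKr. Qed.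

Lemma pvecE (v : E) : pi_q v = 0 -> v = pvec (pi_p1 v) (pi_p2 v).
Proof.
move=> q0; rewrite -[LHS]hsubmxK -/(pi_p v) -/(pi_q v) q0 /pvec; congr row_mx.
rewrite -[LHS]hsubmxK; congr row_mx.
by apply/matrixP => i j; rewrite !ord1 [in RHS]mxE eqxx.
Qed.

Lemma pi_q_eq0 (v : E) : pi_q v = 0 <-> pi_q1 v = 0 /\ pi_q2 v = 0.
Proof.
split=> [q0|[q1 q2]]; first by rewrite /pi_q1 /pi_q2 q0 !linear0 mxE.
rewrite -[LHS]hsubmxK -/(pi_q2 v) q2 (_ : lsubmx _ = 0) ?row_mx0//.
by apply/matrixP => i j; rewrite !ord1 -[LHS]/(pi_q1 v) q1 mxE.
Qed.

Lemma Cr_pi_p1 r (W : normedModType R) (A : set W) (u : W -> E) : open A ->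
  Cr r A u -> Cr r A (fun x => pi_p1 (u x)).
Proof.
have lin : linear (fun v : E => pi_p1 v : R^o).
  by move=> a x y; rewrite /pi_p1 /pi_p !linearP !mxE.
pose l : {linear E -> R^o} := HB.pack (fun v : E => pi_p1 v : R^o)
  (GRing.isLinear.Build _ _ _ _ _ lin).
move=> oA hu; apply: (Cr_lin_comp (l := l) oA _ hu).
exact/finite_frame_continuous/finite_frame_rV.
Qed.

Lemma Cr_pi_q1 r (W : normedModType R) (A : set W) (u : W -> E) : open A ->
  Cr r A u -> Cr r A (fun x => pi_q1 (u x)).
Proof.
have lin : linear (fun v : E => pi_q1 v : R^o).
  by move=> a x y; rewrite /pi_q1 /pi_q !linearP !mxE.
pose l : {linear E -> R^o} := HB.pack (fun v : E => pi_q1 v : R^o)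
  (GRing.isLinear.Build _ _ _ _ _ lin).
move=> oA hu; apply: (Cr_lin_comp (l := l) oA _ hu).
exact/finite_frame_continuous/finite_frame_rV.
Qed.

Lemma Cr_pi_p2 r (W : normedModType R) (A : set W) (u : W -> E) : open A ->
  Cr r A u -> Cr r A (fun x => pi_p2 (u x)).
Proof.
have lin : linear (fun v : E => pi_p2 v).
  by move=> a x y; rewrite /pi_p2 /pi_p !linearP.
pose l : {linear E -> 'rV[R]_m} := HB.pack (fun v : E => pi_p2 v)
  (GRing.isLinear.Build _ _ _ _ _ lin).
move=> oA hu; apply: (Cr_lin_comp (l := l) oA _ hu).
exact/finite_frame_continuous/finite_frame_rV.
Qed.

Lemma Cr_pvec r (W : normedModType R) (A : set W) (u : W -> R) (w : W -> 'rV[R]_m) :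
  open A -> Cr r A u -> Cr r A w -> Cr r A (fun x => pvec (u x) (w x)).
Proof.
have lin : linear (fun v : R^o * 'rV[R]_m => pvec v.1 v.2).
  move=> a x y; rewrite /pvec /= !scale_row_mx !add_row_mx scaler0 addr0.
  by rewrite scale_scalar_mx -raddfD.
pose l : {linear (R^o * 'rV[R]_m)%type -> E} :=
  HB.pack (fun v : R^o * 'rV[R]_m => pvec v.1 v.2) (GRing.isLinear.Build _ _ _ _ _ lin).
move=> oA hu hw; apply: (Cr_lin_comp (l := l) oA _ (Cr_pair oA hu hw)).
apply: finite_frame_continuous; apply: finite_frame_prod; first exact: finite_frame_R.
exact: finite_frame_rV.
Qed.

End coordinates.

(** * Symmetric periodic orbits as zeros of the bifurcation function *)
Lemma card_set3 (T : choiceType) (x y z : T) : y <> z -> x <> y -> x <> z ->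
  ([set x; y; z] #= `I_3)%card.
Proof.
move=> /eqP yz /eqP xy /eqP xz.
have -> : [set x; y; z] = [set` (x |` [fset y; z])%fset].
  apply/seteqP; split=> t /=; rewrite !inE.
    by move=> [[]|] ->; rewrite eqxx ?orbT.
  by move=> /or3P[]/eqP ->; [left; left|left; right|right].
apply/card_eq_fsetP; rewrite cardfsU1 !inE (negbTE xy) (negbTE xz)/=.
by rewrite cardfs2 yz.
Qed.

Section symmetric_orbits.
Context (R : realType) (m : nat) (X : topologicalType)
  (S : smooth_structure X 'rV[R]_((1 + m) + (1 + m)))
  (M : set (R * X)) (f : R -> X -> X).
Hypothesis M_open : open M.
Hypothesis f_C3 : Cr_family S 3 M f.
Hypothesis f_diffeo : forall nu, slice M nu !=set0 ->
  Cr_diffeo_onto_image S 3 (slice M nu) (f nu).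
Context (rho rhoV : X -> X).
Hypothesis rho_rev : reversing_symmetry S M f rho rhoV.
Context (k : nat) (J : set R) (phi chi : chart X 'rV[R]_((1 + m) + (1 + m))).
Hypothesis J_open : open J.
Hypothesis phi_coord : local_coordinates S phi.
Hypothesis phi_slice : slice_chart phi (fixed_by rho).
Hypothesis chi_coord : local_coordinates S chi.
Hypothesis chi_slice : slice_chart chi (fixed_by rho).
Hypothesis U_iter : J `*` cdom phi `<=` iter_dom M f (2 * k).
Context (xfp : R -> X).
Hypothesis xfp_smooth : smooth_curve S J xfp.
Hypothesis xfp_U : forall nu, J nu -> cdom phi (xfp nu).
Hypothesis xfp_fix : forall nu i, J nu -> (1 <= i <= k.-1)%N ->
  Fix (iter (2 * i) (f nu)) (cdom phi) (fixed_by rho) = [set xfp nu].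
Context (P1 : set R) (P2 : set 'rV[R]_m).
Hypothesis P_U : forall p y, P1 p -> P2 y -> ccod phi (pvec p y).
Notation pfp := (fun nu => pi_p1 (cfwd phi (xfp nu))).
Hypothesis pfp_P1 : forall nu, J nu -> P1° (pi_p1 (cfwd phi (xfp nu))).
Hypothesis chi_iter : forall nu p y, J nu -> P1 p -> P2 y ->
  cdom chi (iter k (f nu) (cbwd phi (pvec p y))).
Context (p2 : R * R -> 'rV[R]_m).
Hypothesis p2_smooth : smooth_on (J `*` P1) p2.
Hypothesis p2_P2 : forall z, (J `*` P1) z -> P2° (p2 z).
Hypothesis p2_graph : forall nu p y, J nu -> P1 p -> P2 y ->
  pi_q2 (iter_coord phi chi f k nu p y) = 0 <-> y = p2 (nu, p).
Hypothesis xfp_P2 : forall nu, J nu -> P2 (pi_p2 (cfwd phi (xfp nu))).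
Hypothesis k_ge2 : (2 <= k)%N.
Hypothesis k_even : ~~ odd k.

Notation G := (bif_fun phi chi f k p2).

Definition section_point (nu p : R) : X := cbwd phi (pvec p (p2 (nu, p))).

Let fE := @finite_frame_rV R ((1 + m) + (1 + m)).
Let D : set (R * R) := J `*` P1°.
Let oD : open D. Proof. exact: open_rect. Qed.
Let P1W p : P1° p -> P1 p. Proof. exact: interior_subset. Qed.
Let P2W y : P2° y -> P2 y. Proof. exact: interior_subset. Qed.
Let DW z : D z -> (J `*` P1) z.
Proof. by move=> [? /P1W]. Qed.

(* As k is even, the k-th iterate of f is the (k/2)-th iterate of f^2, and k/2
   is one of the exponents for which the fixed points of f^2 are known. *)
Let khalf : (2 * k./2)%N = k.
Proof. by rewrite mul2n even_halfK. Qed.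

Let khalf_range : (1 <= k./2 <= k.-1)%N.
Proof.
have := khalf; case: (k./2) => [|h] e; move: k_ge2; rewrite -e // mul2n doubleS /= => _.
by rewrite ltnS -addnn leq_addr.
Qed.

Lemma f_inj nu x y : M (nu, x) -> M (nu, y) -> f nu x = f nu y -> x = y.
Proof.
move=> Mx My e; have [|_ _ [g [gK _]]] := f_diffeo (nu := nu); first by exists x.
by rewrite -(gK x Mx) e gK.
Qed.

Lemma f_rev nu x : M (nu, x) -> f nu (rho (f nu x)) = rho x.
Proof.
by move=> Mx; rewrite -[RHS](congr1 rho (reversing_id rho_rev Mx)) (reversing_VK rho_rev).
Qed.

Lemma f_revM nu x : M (nu, x) -> M (nu, rho (f nu x)).
Proof. by move=> Mx; apply: (reversing_sub rho_rev (nu := nu)); exists x. Qed.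

Let orbit nu x i : J nu -> cdom phi x -> (i < 2 * k)%N -> M (nu, iter i (f nu) x).
Proof. by move=> Jn Ux ik; apply: (@U_iter (nu, x)). Qed.

Let k_le2k i : (i < k)%N -> (i < 2 * k)%N.
Proof. by move=> ik; rewrite mul2n -addnn ltn_addr. Qed.

(** This turns the periodicity of a symmetric point, a condition on 2k iterates,
    into the symmetry of its k-th iterate, which is one equation [q = 0]. *)
Lemma return_symmetric nu x : J nu -> cdom phi x -> rho x = x ->
  rho (iter k (f nu) x) = iter k (f nu) x <->
  iter k (f nu) (iter k (f nu) x) = x.
Proof.
move=> Jn Ux rx; have rev := @f_rev nu; have revM := @f_revM nu.
have inj := @f_inj nu; split.
  apply: (symmetric_periodic (N := slice M nu) rev revM) => // i /k_le2k.
  exact: orbit.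
apply: (periodic_symmetric (N := slice M nu) rev revM inj) => // i.
exact: orbit.
Qed.

Lemma iter_square j nu x : iter j (fun y => iter 2 (f nu) y) x = iter (2 * j) (f nu) x.
Proof. by rewrite mulnC iterM. Qed.

Lemma p2_Coo r : Cr r D p2.
Proof.
have [V [h [oV PV hC e]]] := p2_smooth.
have DV : D `<=` V by move=> z /DW/PV.
apply: (Cr_ext oD _ (Cr_sub DV (hC r))) => z /DW Dz.
by rewrite e.
Qed.

Lemma section_ccod nu p : J nu -> P1 p -> ccod phi (pvec p (p2 (nu, p))).
Proof. by move=> Jn Pp; apply: P_U => //; apply/P2W/p2_P2. Qed.

Lemma section_coord nu p : J nu -> P1 p ->
  cfwd phi (section_point nu p) = pvec p (p2 (nu, p)).
Proof. by move=> Jn Pp; rewrite /section_point cbwdK//; exact: section_ccod. Qed.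

Lemma slice_fixed (c : chart X 'rV[R]_((1 + m) + (1 + m))) x :
  slice_chart c (fixed_by rho) -> cdom c x ->
  rho x = x <-> pi_q (cfwd c x) = 0.
Proof.
move=> cs cx; split=> [rx|q0].
  have : (fixed_by rho `&` cdom c) x by [].
  by rewrite cs => -[].
have : [set x | cdom c x /\ pi_q (cfwd c x) = 0] x by [].
by rewrite -cs => -[].
Qed.

Lemma bwd_cdom p y : P1 p -> P2 y -> cdom phi (cbwd phi (pvec p y)).
Proof. by move=> Pp Py; apply: cbwd_in; exact: P_U. Qed.

Lemma bwd_fixed p y : P1 p -> P2 y ->
  rho (cbwd phi (pvec p y)) = cbwd phi (pvec p y).
Proof.
move=> Pp Py; apply/(slice_fixed phi_slice); first exact: bwd_cdom.
by rewrite cbwdK ?pi_q_pvec//; exact: P_U.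
Qed.

Lemma section_cdom nu p : J nu -> P1 p -> cdom phi (section_point nu p).
Proof. by move=> Jn Pp; apply: bwd_cdom => //; apply/P2W/p2_P2. Qed.

Lemma section_fixed nu p : J nu -> P1 p -> rho (section_point nu p) = section_point nu p.
Proof. by move=> Jn Pp; apply: bwd_fixed => //; apply/P2W/p2_P2. Qed.

Lemma section_Cr r : Cr_into S r D (fun z => section_point z.1 z.2).
Proof.
have h : Cr r D (fun z : R * R => pvec z.2 (p2 z)).
  by apply: Cr_pvec => //; [apply: Cr_snd => //; exact: Cr_id|exact: p2_Coo].
have := Cr_into_bwd fE oD phi_coord h.
rewrite (_ : cbwd phi \o _ = fun z => section_point z.1 z.2).
  by apply=> -[nu p] /DW[Jn Pp]; exact: section_ccod.
by apply/funext => -[nu p].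
Qed.

Lemma return_Cr : Cr_into S 3 D (fun z => iter k (f z.1) (section_point z.1 z.2)).
Proof.
apply: (Cr_into_iter fE f_C3 oD); [|exact: section_Cr|].
  by apply: Cr_fst => //; exact: Cr_id.
move=> [nu p] /DW[Jn Pp] i /k_le2k ik; apply: orbit => //.
exact: section_cdom.
Qed.

Lemma bif_fun_C3 : Cr 3 D (fun z => G z.1 z.2).
Proof.
have := Cr_into_fwd fE oD chi_coord return_Cr.
set D' := D `&` _; have -> : D' = D.
  apply/seteqP; split=> [z []//|[nu p] /[dup] Dz /DW[Jn Pp]]; split=> //=.
  by apply: chi_iter => //; apply/P2W/p2_P2.
by move=> /(Cr_pi_q1 oD).
Qed.

(** [q = 0] splits into [q2 = 0], solved by [y = p2 (nu, p)], and [q1 = 0], which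
    on that solution is the vanishing of the bifurcation function. *)
Lemma symmetric_return nu p y : J nu -> P1 p -> P2 y ->
  rho (iter k (f nu) (cbwd phi (pvec p y))) = iter k (f nu) (cbwd phi (pvec p y)) <->
  y = p2 (nu, p) /\ G nu p = 0.
Proof.
move=> Jn Pp Py.
apply: (iff_trans (slice_fixed chi_slice (chi_iter Jn Pp Py))).
apply: (iff_trans (pi_q_eq0 _)); rewrite -/(iter_coord phi chi f k nu p y).
split=> [[q1 /p2_graph e]|[e]].
  by have ye := e Jn Pp Py; rewrite /bif_fun -ye.
by rewrite /bif_fun -e => ->; split=> //; apply/p2_graph.
Qed.

Lemma zero_return nu p : J nu -> P1 p -> G nu p = 0 ->
  rho (iter k (f nu) (section_point nu p)) = iter k (f nu) (section_point nu p) /\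
  iter k (f nu) (iter k (f nu) (section_point nu p)) = section_point nu p.
Proof.
move=> Jn Pp G0.
have h : rho (iter k (f nu) (section_point nu p)) = iter k (f nu) (section_point nu p).
  by apply/symmetric_return => //; apply/P2W/p2_P2.
split=> //; apply/return_symmetric => //; first exact: section_cdom.
exact: section_fixed.
Qed.

Lemma symmetric_coord x : cdom phi x -> rho x = x ->
  x = cbwd phi (pvec (pi_p1 (cfwd phi x)) (pi_p2 (cfwd phi x))).
Proof.
move=> Ux /(slice_fixed phi_slice Ux)/pvecE e.
by rewrite -e cfwdK.
Qed.

Lemma symmetric_return_zero nu x : J nu -> cdom phi x ->
  P1 (pi_p1 (cfwd phi x)) -> P2 (pi_p2 (cfwd phi x)) -> rho x = x ->
  rho (iter k (f nu) x) = iter k (f nu) x ->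
  x = section_point nu (pi_p1 (cfwd phi x)) /\ G nu (pi_p1 (cfwd phi x)) = 0.
Proof.
move=> Jn Ux Px Py rx rk; have e := symmetric_coord Ux rx.
move: rk; rewrite {1 2}e => /symmetric_return => /(_ Jn Px Py)[e2 G0].
by split => //; rewrite /section_point -e2.
Qed.

Lemma xfp_properties nu : J nu -> rho (xfp nu) = xfp nu /\
  iter k (f nu) (xfp nu) = xfp nu.
Proof.
move=> Jn; have : [set xfp nu] (xfp nu) by [].
by rewrite -(xfp_fix Jn khalf_range) khalf => -[_ ? ?].
Qed.

Lemma xfp_section nu : J nu -> xfp nu = section_point nu (pi_p1 (cfwd phi (xfp nu))) /\
  G nu (pi_p1 (cfwd phi (xfp nu))) = 0.
Proof.
move=> Jn; have [r1 k1] := xfp_properties Jn.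
apply: symmetric_return_zero => //; [exact: xfp_U|exact/P1W/pfp_P1|exact: xfp_P2|].
by rewrite k1.
Qed.

(** A symmetric fixed point of f^k = (f^2)^(k/2) is on the given curve. *)
Lemma return_fixed nu x : J nu -> cdom phi x -> rho x = x -> iter k (f nu) x = x ->
  x = xfp nu.
Proof.
move=> Jn Ux rx kx.
have : Fix (iter (2 * k./2) (f nu)) (cdom phi) (fixed_by rho) x.
  by split=> //; rewrite khalf.
by rewrite xfp_fix.
Qed.

Lemma section_pi_p1 nu p : J nu -> P1 p -> pi_p1 (cfwd phi (section_point nu p)) = p.
Proof. by move=> Jn Pp; rewrite section_coord// pi_p1_pvec. Qed.

(** The k-th iterate exchanges symmetric 2k-periodic points.  The last two
    conclusions hold because it fixes the point of the curve [xfp], and fixes no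
    other symmetric point. *)
Lemma return_zero nu p (y := iter k (f nu) (section_point nu p))
    (s := pi_p1 (cfwd phi y)) : J nu -> P1 p -> G nu p = 0 ->
  cdom phi y -> P1 s -> P2 (pi_p2 (cfwd phi y)) ->
  [/\ y = section_point nu s, G nu s = 0,
      (s = pi_p1 (cfwd phi (xfp nu)) -> p = pi_p1 (cfwd phi (xfp nu))) &
      (s = p -> p = pi_p1 (cfwd phi (xfp nu)))].
Proof.
move=> Jn Pp G0 Uy Ps Py; have [ry yy] := zero_return Jn Pp G0.
have [ey Gs] : y = section_point nu s /\ G nu s = 0.
  apply: symmetric_return_zero => //.
  by rewrite /y yy section_fixed.
split=> // [es|es].
  have : section_point nu p = xfp nu.
    rewrite -yy -/y ey es -(xfp_section Jn).1.
    by have [] := xfp_properties Jn.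
  by move/(congr1 (fun x => pi_p1 (cfwd phi x))); rewrite section_pi_p1.
have : section_point nu p = xfp nu.
  apply: return_fixed => //; [exact: section_cdom|exact: section_fixed|].
  by rewrite -/y ey es.
by move/(congr1 (fun x => pi_p1 (cfwd phi x))); rewrite section_pi_p1.
Qed.

Lemma pfp_Coo r : Cr r J pfp.
Proof.
have := Cr_into_fwd fE J_open phi_coord (xfp_smooth r).
set J' := J `&` _; have -> : J' = J.
  by apply/seteqP; split=> [z []//|nu Jn]; split=> //=; exact: xfp_U.
by move=> /(Cr_pi_p1 J_open).
Qed.

Lemma pi_p1_continuous : continuous (@pi_p1 R m).
Proof.
have oE : open [set: 'rV[R]_((1 + m) + (1 + m))] by exact: openT.
by move=> v; apply: (Cr_cont (A := setT) (Cr_pi_p1 oE (Cr_id 0 _))).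
Qed.

Lemma pi_p2_continuous : continuous (@pi_p2 R m).
Proof.
have oE : open [set: 'rV[R]_((1 + m) + (1 + m))] by exact: openT.
by move=> v; apply: (Cr_cont (A := setT) (Cr_pi_p2 oE (Cr_id 0 _))).
Qed.

Lemma chart_box_open (u v : R) (Q : set 'rV[R]_m) : open Q ->
  open (cdom phi `&` cfwd phi @^-1` [set w | u < pi_p1 w < v /\ Q (pi_p2 w)]).
Proof.
move=> oQ; apply: open_setI_preimage; [exact: cdom_open|move=> x; exact: cfwd_cont|].
have -> : [set w | u < pi_p1 w < v /\ Q (pi_p2 w)] =
    ([set: _] `&` (@pi_p1 R m) @^-1` `]u, v[) `&` (@pi_p2 R m) @^-1` Q.
  apply/seteqP; split=> w; rewrite /= in_itv/=.
    by move=> [? ?].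
  by move=> [[_ ?] ?].
apply: open_setI_preimage; [|move=> z _; exact: pi_p2_continuous|exact: oQ].
apply: open_setI_preimage; [exact: openT|move=> z _; exact: pi_p1_continuous|].
exact: interval_open.
Qed.

(** * From the shape of the zero set to the bifurcation *)

(** [nu = n p] is the curve of zeros of the reduced function, with its minimum at
    the crossing [p0]; [swap] is the action of the k-th iterate on its points. *)
Section branches.
Context (n : R -> R) (p0 r : R).
Hypothesis r_gt0 : 0 < r.
Hypothesis near_P1 : forall p, `|p - p0| <= r -> P1° p.
Hypothesis n_Coo : forall s, Cr s P1° n.
Hypothesis nJ : forall p, P1 p -> J (n p).
Hypothesis zeros : forall nu p, J nu -> P1° p ->
  G nu p = 0 <-> p = pi_p1 (cfwd phi (xfp nu)) \/ nu = n p.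
Hypothesis p0_cross : p0 = pi_p1 (cfwd phi (xfp (n p0))).
Hypothesis n_min : forall p, `|p - p0| <= r -> p <> p0 -> n p0 < n p.
Hypothesis n_injl : forall p q, p0 - r <= p <= p0 -> p0 - r <= q <= p0 ->
  n p = n q -> p = q.
Hypothesis n_injr : forall p q, p0 <= p <= p0 + r -> p0 <= q <= p0 + r ->
  n p = n q -> p = q.
Hypothesis dn_neq0 : forall p, `|p - p0| <= r -> p <> p0 -> 'd n p 1 != 0.
Hypothesis swap : forall p q, p0 - r <= p < p0 -> p0 < q <= p0 + r -> n p = n q ->
  iter k (f (n p)) (section_point (n p) p) = section_point (n p) q /\
  iter k (f (n p)) (section_point (n p) q) = section_point (n p) p.

(* In the box all of the symmetric points which return symmetrically are of the
   form [section_point nu p], by the graph property of [p2]. *)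
Let box : set 'rV[R]_((1 + m) + (1 + m)) :=
  [set v | p0 - r < pi_p1 v < p0 + r /\ P2° (pi_p2 v)].
Let U' : set X := cdom phi `&` cfwd phi @^-1` box.

Let U'_open : open U'.
Proof. by apply: chart_box_open; exact: open_interior. Qed.

Let P10 p : `|p - p0| < r -> P1 p.
Proof. by move=> /ltW/near_P1/P1W. Qed.

Let section_U' nu p : J nu -> `|p - p0| < r -> U' (section_point nu p).
Proof.
move=> Jn pr; have Pp := P10 pr; split; first exact: section_cdom.
rewrite /preimage/= /box/= section_coord// pi_p1_pvec pi_p2_pvec; split.
  by move: pr; rewrite ltr_norml; lra.
exact: p2_P2.
Qed.

Let P1p0 : P1 p0.
Proof. by apply: P10; rewrite subrr normr0. Qed.

Let J0 : J (n p0).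
Proof. exact: nJ. Qed.

Let p1xfp nu := pi_p1 (cfwd phi (xfp nu)).

Let Fix_lower nu p : J nu -> `|p1xfp nu - p0| < r -> (1 <= p < k)%N ->
  Fix (iter p (fun x => iter 2 (f nu) x)) U' (fixed_by rho) = [set xfp nu].
Proof.
move=> Jn near pk; have pk' : (1 <= p <= k.-1)%N.
  by move: pk => /andP[-> pk] /=; rewrite -ltnS prednK // (leq_trans _ k_ge2).
rewrite -(xfp_fix Jn pk'); apply/seteqP; split=> x [Ux gx rx].
  by split=> //; [case: Ux|rewrite -iter_square].
have : Fix (iter (2 * p) (f nu)) (cdom phi) (fixed_by rho) x by [].
rewrite (xfp_fix Jn pk') => /= xe; split=> //; last by rewrite iter_square.
by rewrite xe (xfp_section Jn).1; exact: section_U'.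
Qed.

Let Fix_k nu x : J nu ->
  Fix (iter k (fun x => iter 2 (f nu) x)) U' (fixed_by rho) x <->
  exists p, [/\ `|p - p0| < r, x = section_point nu p &
     p = p1xfp nu \/ nu = n p].
Proof.
move=> Jn; have iterk2 y : iter (2 * k) (f nu) y = iter k (f nu) (iter k (f nu) y).
  by rewrite -iterD addnn mul2n.
rewrite /Fix/= iter_square iterk2; split=> [[[Ux [xr xP]] gx rx]|[p [pr -> h]]].
  have pr : `|pi_p1 (cfwd phi x) - p0| < r by rewrite ltr_norml; lra.
  have rk := (return_symmetric Jn Ux rx).2 gx.
  have [ex G0] := symmetric_return_zero Jn Ux (P10 pr) (P2W xP) rx rk.
  exists (pi_p1 (cfwd phi x)); split=> //.
  by apply/zeros => //; exact/near_P1/ltW.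
have Pp := P10 pr.
have G0 : G nu p = 0 by apply/zeros => //; exact/near_P1/ltW.
have [_ kk] := zero_return Jn Pp G0.
by split=> //; [exact: section_U'|exact: section_fixed].
Qed.

(** [xb1] and [xb2] are the section points over the two inverses [h1], [h2] of
    [n].  In the box, the symmetric fixed points of the k-th iterate of f^2 are
    the section points over the zeros of G: below [n p0] there is only the fixed
    point, above it the two branches are added.  They are distinct from the fixed
    point because f^k fixes the latter but exchanges the branches. *)
Lemma branches_tupling : period_tupling S (iter_dom M f 2) (fun nu => iter 2 (f nu))
  (fixed_by rho) k (n p0) (section_point (n p0) p0).
Proof.
set nus := n p0.
have cn p : `|p - p0| <= r -> {for p, continuous n}.
  by move=> /near_P1; exact: (Cr_cont (n_Coo 0)).
have rl : `|(p0 - r) - p0| <= r by rewrite addrAC subrr add0r normrN gtr0_norm.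
have rr : `|(p0 + r) - p0| <= r by rewrite addrAC subrr add0r gtr0_norm.
have r0 := r_gt0.
have nl : n p0 < n (p0 - r) by apply: n_min => //; lra.
have nr : n p0 < n (p0 + r) by apply: n_min => //; lra.
have [||h1 [h1P h1n h1K h1C]] := @decreasing_branch _ n (p0 - r) p0 _ _ n_injl nl.
- by lra.
- by move=> x xr; apply: cn; rewrite ler_norml; lra.
have [||h2 [h2P h2n h2K h2C]] := @increasing_branch _ n p0 (p0 + r) _ _ n_injr nr.
- by lra.
- by move=> x xr; apply: cn; rewrite ler_norml; lra.
(* The parameter interval is chosen so small that the fixed point stays in the
   box, and that both branches reach [nu2] before they leave it. *)
have [e e0 he] : exists2 e, 0 < e & forall nu, `|nu - nus| < e ->
    J nu /\ `|p1xfp nu - p0| < r.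
  have cpf : {for nus, continuous p1xfp} by apply: (Cr_cont (pfp_Coo 0)).
  have nJ0 : \forall nu \near nus, J nu by exact: open_nbhs_nbhs.
  have npf : \forall nu \near nus, `|p1xfp nu - p0| < r.
    have -> : p0 = p1xfp nus by exact: p0_cross.
    by have /cvgr_distC_lt := cpf; apply.
  have : \forall nu \near nus, J nu /\ `|p1xfp nu - p0| < r by exact: filterI.
  move=> /nbhs_ballP[e /= e0 he]; exists e => // nu nue.
  by apply: he; rewrite /ball/= distrC.
pose d := Num.min e (Num.min (n (p0 - r) - nus) (n (p0 + r) - nus)) / 2.
have [d0 de dl dr] : [/\ 0 < d, d < e, nus + d < n (p0 - r) & nus + d < n (p0 + r)].
  have h0 : 0 < Num.min e (Num.min (n (p0 - r) - nus) (n (p0 + r) - nus)).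
    by rewrite !lt_min e0 !subr_gt0 nl nr.
  have k1 : Num.min e (Num.min (n (p0 - r) - nus) (n (p0 + r) - nus)) <= e.
    by rewrite !ge_min lexx.
  have k2 : Num.min e (Num.min (n (p0 - r) - nus) (n (p0 + r) - nus)) <= n (p0 - r) - nus.
    by rewrite !ge_min lexx orbT.
  have k3 : Num.min e (Num.min (n (p0 - r) - nus) (n (p0 + r) - nus)) <= n (p0 + r) - nus.
    by rewrite !ge_min lexx !orbT.
  by rewrite /d; split; lra.
pose nu1 := nus - d; pose nu2 := nus + d.
have nearnu nu : nu1 <= nu <= nu2 -> J nu /\ `|p1xfp nu - p0| < r.
  by move=> nn; apply: he; rewrite ltr_norml /nu1 /nu2 in nn *; lra.
have right nu : nus <= nu <= nu2 -> nu1 <= nu <= nu2 by rewrite /nu1 /nu2; lra.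
have H1 nu : nus <= nu <= nu2 -> [/\ p0 - r < h1 nu, h1 nu <= p0, n (h1 nu) = nu &
    nus < nu -> h1 nu < p0].
  rewrite /nu2 => nn; have [h1r h1e] : p0 - r <= h1 nu <= p0 /\ n (h1 nu) = nu.
    by apply: h1P; rewrite -/nus; lra.
  split=> //; last 2 first.
  - by lra.
  - move=> lt; rewrite lt_neqAle; apply/andP; split; last by lra.
    by apply/eqP => eh; move: h1e lt; rewrite eh => <-; rewrite ltxx.
  rewrite lt_neqAle; apply/andP; split; last by lra.
  by apply/eqP => eh; move: h1e; rewrite -eh; lra.
have H2 nu : nus <= nu <= nu2 -> [/\ p0 <= h2 nu, h2 nu < p0 + r, n (h2 nu) = nu &
    nus < nu -> p0 < h2 nu].
  rewrite /nu2 => nn; have [h2r h2e] : p0 <= h2 nu <= p0 + r /\ n (h2 nu) = nu.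
    by apply: h2P; rewrite -/nus; lra.
  split=> //; first by lra.
  - rewrite lt_neqAle; apply/andP; split; last by lra.
    by apply/eqP => eh; move: h2e; rewrite eh; lra.
  - move=> lt; rewrite lt_neqAle; apply/andP; split; last by lra.
    by apply/eqP => eh; move: h2e lt; rewrite -eh => <-; rewrite ltxx.
have h1near nu : nus <= nu <= nu2 -> `|h1 nu - p0| < r.
  by move=> /H1[? ? _ _]; rewrite ltr_norml; lra.
have h2near nu : nus <= nu <= nu2 -> `|h2 nu - p0| < r.
  by move=> /H2[? ? _ _]; rewrite ltr_norml; lra.
pose xb1 nu := section_point nu (h1 nu); pose xb2 nu := section_point nu (h2 nu).
have U'int x : U' x -> U'° x by move=> Ux; rewrite (interior_id U').1.
have h1s : h1 nus = p0 by apply: h1K; lra.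
have h2s : h2 nus = p0 by apply: h2K; lra.
have swap_b nu : nus < nu <= nu2 ->
    iter k (f nu) (xb1 nu) = xb2 nu /\ iter k (f nu) (xb2 nu) = xb1 nu.
  move=> /andP[n1 n2]; have nn : nus <= nu <= nu2 by lra.
  have [a1 a2 a3 /(_ n1) a4] := H1 _ nn; have [b1 b2 b3 /(_ n1) b4] := H2 _ nn.
  have [] := @swap (h1 nu) (h2 nu); rewrite ?a3 ?b3//; lra.
have distinct nu : nus < nu <= nu2 ->
    [/\ xb1 nu <> xb2 nu, xfp nu <> xb1 nu & xfp nu <> xb2 nu].
  move=> nn; have [s1 s2] := swap_b _ nn; have /andP[n1 n2] := nn.
  have nn' : nus <= nu <= nu2 by lra.
  have [Jn _] := nearnu _ (right _ nn').
  have [a1 a2 a3 /(_ n1) a4] := H1 _ nn'; have [b1 b2 b3 /(_ n1) b4] := H2 _ nn'.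
  have ne : xb1 nu <> xb2 nu.
    move/(congr1 (fun x => pi_p1 (cfwd phi x))).
    rewrite (section_pi_p1 Jn (P10 (h1near _ nn'))).
    by rewrite (section_pi_p1 Jn (P10 (h2near _ nn'))); lra.
  have [_ kx] := xfp_properties Jn.
  by split=> // ex; apply: ne; [rewrite -s1 -ex kx|rewrite -s2 -ex kx].
have Fixk nu : nus <= nu <= nu2 ->
    Fix (iter k (fun x => iter 2 (f nu) x)) U' (fixed_by rho) =
    [set xfp nu; xb1 nu; xb2 nu].
  move=> nn; have [Jn pfr] := nearnu _ (right _ nn).
  have [a1 a2 a3 _] := H1 _ nn; have [b1 b2 b3 _] := H2 _ nn.
  apply/seteqP; split=> x.
    move=> /(Fix_k _ Jn)[p [pr -> [->|np]]].
      by left; left; exact: esym (xfp_section Jn).1.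
    move: pr; rewrite ltr_norml => /andP[pl pg].
    have [pp0|pp0] := leP p p0.
      by left; right; rewrite /= /xb1 np h1K//; lra.
    by right; rewrite /= /xb2 np h2K//; lra.
  move=> xe; apply/(Fix_k _ Jn); case: xe => [[]|] ->.
  - by exists (p1xfp nu); split; [|exact: (xfp_section Jn).1|left].
  - by exists (h1 nu); split; [exact: h1near| |right].
  - by exists (h2 nu); split; [exact: h2near| |right].
have xfps : xfp nus = section_point nus p0.
  by rewrite (xfp_section J0).1 -/nus -p0_cross.
have Mk nu x i : J nu -> cdom phi x -> (i < 2 * k)%N -> M (nu, iter i (f nu) x).
  exact: orbit.
have Jitv nu : nu1 <= nu <= nu2 -> J nu by move=> /nearnu[].
split.
- exact: (open_iter_dom2 M_open f_C3).
- move=> i i2; apply: Mk => //; first exact: section_cdom.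
  by apply: (leq_trans i2); rewrite mul2n -addnn; apply: leq_trans k_ge2 _; rewrite leq_addr.
exists nu1, nu2, U', xfp, xb1, xb2; split.
- split.
    move=> [nu x] [/=]; rewrite in_itv/= => /Jitv Jn [Ux _] i i2; apply: Mk => //=.
    by apply: (leq_trans i2); rewrite mul2n -addnn; apply: leq_trans k_ge2 _; rewrite leq_addr.
  exists (`]nu1, nu2[%classic, U').
    split; apply: open_nbhs_nbhs; split => //.
    + by rewrite /= in_itv/= /nu1 /nu2; lra.
    + by apply: section_U' => //; rewrite subrr normr0.
  move=> [nu x] /= [+ Ux]; rewrite in_itv/= => nn; split=> //=.
  by rewrite in_itv/=; lra.
- move=> p pk [nu x] [/=]; rewrite in_itv/= => /Jitv Jn [Ux _] i ip j j2 /=.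
  rewrite iter_square -iterD; apply: Mk => //.
  move: j2 => /ltnSE; rewrite leq_eqVlt ltnS leqn0 => /orP[]/eqP->.
    by apply: (@leq_trans (2 * i.+1)); [rewrite mulnS|rewrite leq_pmul2l// (leq_trans ip)].
  by rewrite add0n ltn_pmul2l// (leq_trans ip).
- split.
  + move=> nu /nearnu[Jn pfr]; apply: U'int; rewrite (xfp_section Jn).1.
    exact: section_U'.
  + move=> nu nn; have [Jn _] := nearnu _ (right _ nn).
    by split; apply: U'int; apply: section_U' => //; [exact: h1near|exact: h2near].
  + have sub1 : `[nus, nu2]%classic `<=` `[n p0, n (p0 - r)]%classic.
      by move=> nu /=; rewrite !in_itv/= /nu2 -/nus; lra.
    have sub2 : `[nus, nu2]%classic `<=` `[n p0, n (p0 + r)]%classic.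
      by move=> nu /=; rewrite !in_itv/= /nu2 -/nus; lra.
    have h1w := continuous_subspaceW sub1 h1C.
    have h2w := continuous_subspaceW sub2 h2C.
    have cX (h : R -> R) : {within `[nus, nu2], continuous h} ->
        (forall nu, nus <= nu <= nu2 -> `|h nu - p0| < r) ->
        {within `[nus, nu2], continuous (fun nu => section_point nu (h nu))}.
      move=> hw hr; rewrite continuous_subspace_in => nu /set_mem.
      rewrite /= in_itv/= => nn; have [Jn _] := nearnu _ (right _ nn).
      have Dn : D (nu, h nu) by split => //=; apply/near_P1/ltW/hr.
      have cF := Cr_into_cont (section_Cr 0) Dn.
      have cid : {within `[nus, nu2], continuous (@idfun R)}.
        by apply: continuous_subspaceT => x; exact: cvg_id.
      apply: (@continuous_comp (subspace `[nus, nu2]) (R * R)%type X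
        (fun nu => (nu, h nu)) (fun z => section_point z.1 z.2) nu _ cF).
      by apply: continuous_at_pair; [exact: cid|exact: hw].
    split; [|exact: cX|exact: cX].
    apply: continuous_in_subspaceT => nu; rewrite inE/= in_itv/= => /Jitv.
    exact: (Cr_into_cont (xfp_smooth 0)).
  + have smooth (h : R -> R) (B : set R) : open B -> B `<=` P1° ->
        {within `[nus, nu2], continuous h} ->
        (forall nu, nus < nu < nu2 -> B (h nu) /\ n (h nu) = nu) ->
        (forall p, B p -> h (n p) = p) -> (forall p, B p -> 'd n p 1 != 0) ->
        smooth_curve S `]nus, nu2[ (fun nu => section_point nu (h nu)).
      move=> oB BP hw hB hK dn s.
      have oI : open `]nus, nu2[%classic by exact: itv_open.
      have n12 : nus < nu2 by rewrite /nu2; lra.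
      have BI nu : `]nus, nu2[%classic nu -> B (h nu) /\ n (h nu) = nu.
        by rewrite /= in_itv/=; exact: hB.
      have ch : Cr s `]nus, nu2[ h.
        apply: (@Cr_inverse _ s _ B n h oI oB) => //.
        - by move=> nu /BI[].
        - by move=> nu ?; apply: (within_continuous_continuous n12 hw).
        - by move=> nu /BI[].
        - by move=> s'; exact: Cr_sub (n_Coo s').
      have JI nu : `]nus, nu2[%classic nu -> J nu.
        by rewrite /= in_itv/= => nn; apply: Jitv; rewrite /nu1; lra.
      have DI nu : `]nus, nu2[%classic nu -> D (nu, h nu).
        by move=> nn; split => /=; [exact: JI|apply: BP; case: (BI _ nn)].
      apply: (Cr_into_bwd (v := fun nu => pvec (h nu) (p2 (nu, h nu))) fE oI phi_coord).
        apply: Cr_pvec => //.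
        apply: (Cr_comp (f := fun nu => (nu, h nu)) _ oI DI _ (p2_Coo s)).
          by apply: finite_frame_prod; exact: finite_frame_R.
        by apply: Cr_pair => //; exact: Cr_id.
      by move=> nu /DI/DW[]; exact: section_ccod.
    have sub1 : `[nus, nu2]%classic `<=` `[n p0, n (p0 - r)]%classic.
      by move=> nu /=; rewrite !in_itv/= /nu2 -/nus; lra.
    have sub2 : `[nus, nu2]%classic `<=` `[n p0, n (p0 + r)]%classic.
      by move=> nu /=; rewrite !in_itv/= /nu2 -/nus; lra.
    split.
    * by move=> s; apply: Cr_into_sub (xfp_smooth s) => nu /=; rewrite in_itv/= => ?;
        apply: Jitv; lra.
    * apply: (smooth h1 `]p0 - r, p0[%classic (itv_open _ _) _
        (continuous_subspaceW sub1 h1C)).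
      - by move=> p /=; rewrite in_itv/= => ?; apply: near_P1; rewrite ler_norml; lra.
      - move=> nu /andP[n1 n2]; have [|a1 a2 a3 /(_ n1) a4] := H1 nu; first by lra.
        by rewrite /= in_itv/= a1 a4.
      - by move=> p /=; rewrite in_itv/= => ?; apply: h1K; lra.
      - by move=> p /=; rewrite in_itv/= => ?; apply: dn_neq0; [rewrite ler_norml; lra|lra].
    * apply: (smooth h2 `]p0, p0 + r[%classic (itv_open _ _) _
        (continuous_subspaceW sub2 h2C)).
      - by move=> p /=; rewrite in_itv/= => ?; apply: near_P1; rewrite ler_norml; lra.
      - move=> nu /andP[n1 n2]; have [|a1 a2 a3 /(_ n1) a4] := H2 nu; first by lra.
        by rewrite /= in_itv/= a2 a4.
      - by move=> p /=; rewrite in_itv/= => ?; apply: h2K; lra.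
      - by move=> p /=; rewrite in_itv/= => ?; apply: dn_neq0; [rewrite ler_norml; lra|lra].
  + by split; rewrite /xb1 /xb2 ?h1s ?h2s.
- split.
  + move=> nu p /andP[n1 n2] /andP[p1]; have nn : nu1 <= nu <= nu2.
      by rewrite /nu2; lra.
    have [Jn pfr] := nearnu _ nn.
    rewrite leq_eqVlt => /orP[/eqP ->|pk]; last by apply: Fix_lower => //; rewrite p1.
    apply/seteqP; split=> x.
      move=> /(Fix_k _ Jn)[q [qr -> [->|nq]]].
        exact: esym (xfp_section Jn).1.
      have qp0 : q = p0.
        apply: contrapT => /(n_min (ltW qr)); rewrite -nq -/nus; lra.
      by rewrite /= nq qp0 -/nus xfps.
    move=> ->; apply/(Fix_k _ Jn); exists (p1xfp nu).
    by split; [|exact: (xfp_section Jn).1|left].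
  + move=> nu p /right/nearnu[Jn pfr] pk; exact: Fix_lower.
  + exact: Fixk.
  + move=> nu nn; have nn' : nus <= nu <= nu2 by lra.
    by rewrite (Fixk _ nn'); have [d1 d2 d3] := distinct _ nn; exact: card_set3.
- move=> _ nu nn; rewrite !iter_square khalf.
  exact: swap_b.
Qed.

End branches.

End symmetric_orbits.

Theorem theorem9 (R : realType) (m : nat) (X : topologicalType)
  (S : smooth_structure X 'rV[R]_((1 + m) + (1 + m)))
  (M : set (R * X)) (f : R -> X -> X)
  (M_open : open M) (f_C3 : Cr_family S 3 M f)
  (C1 : forall nu, slice M nu !=set0 ->
     Cr_diffeo_onto_image S 3 (slice M nu) (f nu))
  (rho rhoV : X -> X) (rho_rev : reversing_symmetry S M f rho rhoV)
  (k : nat) (nuh : R) (xh : X) (M_h : M (nuh, xh))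
  (J : set R) (J_open : open J) (J_itv : is_interval J) (J_nuh : J nuh)
  (phi : chart X 'rV[R]_((1 + m) + (1 + m)))
  (phi_coord : local_coordinates S phi)
  (phi_slice : slice_chart phi (fixed_by rho))
  (U : set X) (U_def : U = cdom phi) (U_xh : U xh)
  (U_iter : J `*` U `<=` iter_dom M f (2 * k))
  (psi : chart X 'rV[R]_((1 + m) + (1 + m)))
  (psi_coord : local_coordinates S psi)
  (psi_slice : slice_chart psi (fixed_by rho))
  (psi_fxh : cdom psi (f nuh xh))
  (xfp : R -> X) (xfp_smooth : smooth_curve S J xfp)
  (xfp_U : forall nu, J nu -> U (xfp nu))
  (xfp_q : forall nu, J nu -> pi_q (cfwd phi (xfp nu)) = 0)
  (xfp_fix : forall nu i, J nu -> (1 <= i <= k.-1)%N ->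
     Fix (iter (2 * i) (f nu)) U (fixed_by rho) = [set xfp nu])
  (a b : R) (P1 : set R) (P1_def : P1 = `[a, b]%classic)
  (P2 : set 'rV[R]_m) (P2_closed : closed P2)
  (P_U : forall p1 p2, P1 p1 -> P2 p2 -> ccod phi (pvec p1 p2))
  (p1fp : R -> R) (p1fp_def : p1fp = (fun nu => pi_p1 (cfwd phi (xfp nu))))
  (p1fp_P1 : forall nu, J nu -> P1° (p1fp nu))
  (chi : chart X 'rV[R]_((1 + m) + (1 + m)))
  (chi_def : chi = phi \/ chi = psi)
  (chi_iter : forall nu p1 p2, J nu -> P1 p1 -> P2 p2 ->
     cdom chi (iter k (f nu) (cbwd phi (pvec p1 p2))))
  (p2 : R * R -> 'rV[R]_m) (p2_smooth : smooth_on (J `*` P1) p2)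
  (p2_P2 : forall z, (J `*` P1) z -> P2° (p2 z))
  (p2_graph : forall nu p1 y, J nu -> P1 p1 -> P2 y ->
     pi_q2 (iter_coord phi chi f k nu p1 y) = 0 <-> y = p2 (nu, p1))
  (xfp_P2 : forall nu, J nu -> P2 (pi_p2 (cfwd phi (xfp nu))))
  (G : R -> R -> R) (G_def : G = bif_fun phi chi f k p2)
  (g : R -> R -> R) (g_def : g = reduced_bif_fun P1 G p1fp)
  (C3 : exists nup : R -> R,
     [/\ smooth_on P1 nup, (forall p1, P1 p1 -> J (nup p1)) &
         [set z : R * R | (J `*` P1) z /\ g z.1 z.2 = 0]
         = [set (nup p1, p1) | p1 in P1]])
  (C4 : ~ set_add (image_of_prod (dnup P1 G) J P1)
          (set_mul (image_of_prod (dpp P1 G) J P1) (derive1 p1fp @` J)) 0)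
  (k_ge2 : (2 <= k)%N) (k_even : ~~ odd k)
  (sign : set_mul (image_of_prod (dppp P1 G) J P1)
            (set_inv (image_of_prod (dnup P1 G) J P1)) `<=` [set x | x < 0]) :
  exists (nus p1s : R) (p2s : 'rV[R]_m),
    [/\ J nus, P1 p1s, P2 p2s &
        period_tupling S (iter_dom M f 2) (fun nu => iter 2 (f nu))
          (fixed_by rho) k nus (cbwd phi (pvec p1s p2s))].

Proof.
subst U p1fp.
have chi_coord : local_coordinates S chi by case: chi_def => ->.
have chi_slice : slice_chart chi (fixed_by rho) by case: chi_def => ->.
have intP1 p : P1° p <-> a < p < b.
  by rewrite P1_def interior_itv/= in_itv/=.
have P1E p : P1 p <-> a <= p <= b by rewrite P1_def/= in_itv/=.
have P1W p : P1° p -> P1 p by exact: interior_subset.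
pose pf nu := pi_p1 (cfwd phi (xfp nu)).
have pf_ab nu : J nu -> a < pf nu < b by move=> /p1fp_P1/intP1.
have ab : a <= b by have := pf_ab _ J_nuh; lra.
have G3 : Cr 3 (J `*` P1°) (fun z => G z.1 z.2).
  rewrite G_def.
  exact: (bif_fun_C3 f_C3 J_open phi_coord chi_coord U_iter P_U chi_iter p2_smooth p2_P2).
have [Gp2 dG] := dp_Cr J_open G3.
have [Gpp1 dGp] := dp_Cr J_open Gp2.
have [Gppp0 dGpp] := dp_Cr J_open Gpp1.
have DJ nu p : J nu -> a < p < b -> (J `*` P1°) (nu, p) by move=> Jn /intP1.
have dG' nu p (Jn : J nu) (pab : a < p < b) := dG nu p (DJ nu p Jn pab).
have dGp' nu p (Jn : J nu) (pab : a < p < b) := dGp nu p (DJ nu p Jn pab).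
have dGpp' nu p (Jn : J nu) (pab : a < p < b) := dGpp nu p (DJ nu p Jn pab).
have dGp_cont nu : J nu -> forall p, a < p < b -> {for p, continuous (dp P1 G nu)}.
  by move=> Jn p pab; exact: is_derive_continuous (dGp' nu p Jn pab).
have pfC r : Cr r J pf := pfp_Coo J_open phi_coord xfp_smooth xfp_U r.
have dpf nu : J nu -> is_derive nu 1 pf (derive1 pf nu).
  move=> Jn; have dp' : differentiable pf nu by exact: (pfC 1%N).1.
  have dv : derivable pf nu 1 by exact: diff_derivable.
  by rewrite derive1E; exact: derivableP.
have xfpE := xfp_section phi_slice chi_slice xfp_U xfp_fix p1fp_P1 chi_iter p2_graph xfp_P2
  k_ge2 k_even.
have Gpf nu : J nu -> G nu (pf nu) = 0.
  by move=> Jn; rewrite G_def; have [_] := xfpE _ Jn.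
have reduced nu p : J nu -> a < p < b -> (p - pf nu) * g nu p = G nu p.
  move=> Jn pab; rewrite g_def /reduced_bif_fun.
  have h := hadamard_quotient (fun x h => dG' nu x Jn h) (dGp_cont nu Jn) pab (pf_ab _ Jn).
  by rewrite h Gpf// subr0.
have reduced0 nu : J nu -> g nu (pf nu) = dp P1 G nu (pf nu).
  by move=> Jn; rewrite g_def /reduced_bif_fun (hadamard_quotient_diag (dp P1 G nu) (pf nu)).
(* [n] extends the curve nu(p) smoothly beyond the end points of P1, where the
   intermediate value argument for the crossing needs its continuity. *)
have [nup [[V [n [oV PV nC nupE]]] nupJ nupZ]] := C3.
have nJ p : P1 p -> J (n p) by move=> Pp; rewrite -nupE//; exact: nupJ.
have gn p : P1 p -> g (n p) p = 0.
  move=> Pp; have : [set (nup p1, p1) | p1 in P1] (n p, p) by exists p; rewrite ?nupE.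
  by rewrite -nupZ => -[].
have gn_inv nu p : J nu -> P1 p -> g nu p = 0 -> nu = n p.
  move=> Jn Pp g0; have : [set z : R * R | (J `*` P1) z /\ g z.1 z.2 = 0] (nu, p) by [].
  by rewrite nupZ => -[q Pq [<- <-]]; rewrite nupE.
have zeros nu p : J nu -> P1° p -> G nu p = 0 <-> p = pf nu \/ nu = n p.
  move=> Jn Pp; have pab := (intP1 p).1 Pp; split=> [G0|[->|e]]; last 2 first.
  - exact: Gpf.
  - by rewrite -reduced// e gn ?mulr0//; exact: P1W.
  move: (reduced _ _ Jn pab); rewrite G0 => /eqP; rewrite mulf_eq0 subr_eq0.
  by move=> /orP[/eqP ->|/eqP g0]; [left|right; apply: gn_inv => //; exact: P1W].
have nC' r : Cr r P1° n by apply: Cr_sub (nC r) => p /P1W/PV.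
have n_cont p : P1 p -> {for p, continuous n} by move=> /PV; exact: (Cr_cont (nC 0)).
have dn p : a < p < b -> is_derive p 1 n ('d n p 1).
  move=> /intP1 Pp; have dn' : differentiable n p by exact: (nC' 1%N).1.
  have dv : derivable n p 1 by exact: diff_derivable.
  by rewrite -deriveE//; exact: derivableP.
have Gn p : a < p < b -> G (n p) p = 0.
  by move=> pab; apply/zeros; [exact/nJ/P1W/intP1|exact/intP1|right].
have touch p : a < p < b -> p = pf (n p) -> dp P1 G (n p) p = 0.
  move=> pab e; have Pp := P1W _ ((intP1 p).2 pab).
  by rewrite {2}e -reduced0 -?e ?gn//; exact: nJ.
(* The derivative of [G (n p) p = 0] is [n'(p) G_nu + G_p = 0]. *)
have flat p : a < p < b -> 'd n p 1 = 0 -> dp P1 G (n p) p = 0.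
  move=> pab dn0; have Pp := (intP1 p).2 pab.
  have dGz : differentiable (fun z => G z.1 z.2) (n p, p) by apply: G3.1; split => //; exact/nJ/P1W.
  have := is_derive_comp_pair dGz (dn p pab) (is_derive_id p 1).
  rewrite dn0 mul0r add0r mul1r => h.
  have [_ ->] := dp_is_derive dGz Pp.
  have h0 : is_derive p 1 (cst (0 : R)) ('d (fun z : R * R => G z.1 z.2) (n p, p) (0, 1)).
    apply: near_eq_is_derive h.
    have : \forall q \near p, P1° q by apply: open_nbhs_nbhs; split => //; exact: open_interior.
    by apply: filterS => q /intP1/Gn /= ->.
  by rewrite -(@derive_val _ _ _ _ _ _ _ h0) derive_cst.
have Dprod nu p nu' p' : J nu -> a < p < b -> J nu' -> a < p' < b ->
    dppp P1 G nu p * dnup P1 G nu' p' < 0.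
  move=> Jn pab Jn' pab'; have Pp := P1W _ ((intP1 p).2 pab).
  have Pp' := P1W _ ((intP1 p').2 pab').
  have : dppp P1 G nu p * (dnup P1 G nu' p')^-1 < 0.
    apply: sign; exists (dppp P1 G nu p); first by exists nu => //; exists p.
    exists (dnup P1 G nu' p')^-1 => //; exists (dnup P1 G nu' p') => //.
    by exists nu' => //; exists p'.
  set u := dppp _ _ _ _; set v := dnup _ _ _ _ => uv.
  have v0 : v != 0 by apply/eqP => v0; move: uv; rewrite v0 invr0 mulr0 ltxx.
  have -> : u * v = u * v^-1 * v ^+ 2 by rewrite expr2 mulrA mulfVK.
  rewrite pmulr_llt0//.
  by rewrite lt_neqAle sqr_ge0 andbT eq_sym sqrf_eq0.
have transv nu p nu' p' nu'' : J nu -> a < p < b -> J nu' -> a < p' < b -> J nu'' ->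
    dnup P1 G nu p + dpp P1 G nu' p' * derive1 pf nu'' != 0.
  move=> Jn pab Jn' pab' Jn''; have Pp := P1W _ ((intP1 p).2 pab).
  have Pp' := P1W _ ((intP1 p').2 pab').
  apply/eqP => e; apply: C4; exists (dnup P1 G nu p); first by exists nu => //; exists p.
  exists (dpp P1 G nu' p' * derive1 pf nu'') => //.
  exists (dpp P1 G nu' p'); first by exists nu' => //; exists p'.
  by exists (derive1 pf nu'') => //; exists nu''.
have dslope nu : J nu -> is_derive nu 1 (fun t => dp P1 G t (pf t))
    (dnup P1 G nu (pf nu) + dpp P1 G nu (pf nu) * derive1 pf nu).
  move=> Jn; apply: is_derive_dp_along; [|exact: p1fp_P1|exact: dpf].
  by apply: Gp2.1; split => //; exact: p1fp_P1.
have pf_cont nu : J nu -> {for nu, continuous pf} by exact: (Cr_cont (pfC 0)).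
have nJ' p : a <= p <= b -> J (n p) by move=> /P1E; exact: nJ.
have n_cont' p : a <= p <= b -> {for p, continuous n} by move=> /P1E; exact: n_cont.
have [p0 p0ab p0c] := crossing_exists pf_ab pf_cont ab nJ' n_cont'.
have J0 : J (n p0) by apply: nJ; exact/P1W/intP1.
(* [y p] is the k-th iterate of the periodic point over [p], and [s p] its first
   coordinate: [s] is the partner map. *)
pose y p := iter k (f (n p)) (section_point phi p2 (n p) p).
pose s p := pi_p1 (cfwd phi (y p)).
have y_cont p : a < p < b -> {for p, continuous y}.
  move=> pab; have Dn := DJ _ _ (nJ _ (P1W _ ((intP1 p).2 pab))) pab.
  have cF := Cr_into_cont (return_Cr f_C3 J_open phi_coord U_iter P_U p2_smooth p2_P2) Dn.
  apply: (@continuous_comp R (R * R)%type X (fun p => (n p, p))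
    (fun z => iter k (f z.1) (section_point phi p2 z.1 z.2)) p _ cF).
  apply: continuous_at_pair; last exact: cvg_id.
  by apply: n_cont; exact/P1W/intP1.
have [xr kx] := xfp_properties xfp_fix k_ge2 k_even J0.
have y0 : y p0 = xfp (n p0).
  by rewrite /y -[in RHS]kx (xfpE _ J0).1 -/(pf _) -p0c.
(* [y p0] is the fixed point itself, hence for [p] close to [p0] the point [y p]
   lies where the graph description of the symmetric returns is valid. *)
pose box := cdom phi `&` cfwd phi @^-1` [set w | a < pi_p1 w < b /\ P2° (pi_p2 w)].
have box_open : open box by apply: chart_box_open; exact: open_interior.
have box0 : box (y p0).
  rewrite y0; split; first exact: xfp_U.
  split; first exact: pf_ab.
  rewrite (xfpE _ J0).1 (section_coord P_U p2_P2)//; last exact/P1W/p1fp_P1.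
  by rewrite pi_p2_pvec; apply: p2_P2; split => //; exact/P1W/p1fp_P1.
have [r0 r0_gt0 hr0] : exists2 r0, 0 < r0 & forall p, `|p - p0| < r0 -> a < p < b /\ box (y p).
  have near1 : \forall p \near p0, P1° p.
    by apply: open_nbhs_nbhs; split; [exact: open_interior|exact/intP1].
  have near2 : \forall p \near p0, box (y p).
    exact: (y_cont p0 p0ab box (open_nbhs_nbhs (conj box_open box0))).
  have near12 : \forall p \near p0, P1° p /\ box (y p) by exact: filterI.
  have [e e0 he] := (nbhs_ballP _ _).1 near12; exists e => // p pe.
  have pb : ball p0 e p by rewrite -ball_normE/= distrC.
  by have [Pp yp] := he p pb; split; [exact/intP1|exact: yp].
have partner p : `|p - p0| < r0 ->
    [/\ y p = section_point phi p2 (n p) (s p), G (n p) (s p) = 0, a < s p < b,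
        (s p = pf (n p) -> p = pf (n p)) & (s p = p -> p = pf (n p))].
  move=> /hr0[pab [yU [sab yP]]].
  have Pp := P1W _ ((intP1 p).2 pab); have Ps := P1W _ ((intP1 (s p)).2 sab).
  have [||e1 e2 e3 e4] := return_zero C1 rho_rev phi_slice chi_slice U_iter xfp_U xfp_fix
    P_U p1fp_P1 chi_iter p2_P2 p2_graph xfp_P2 k_ge2 k_even (nJ _ Pp) Pp _ yU Ps.
  - by rewrite -G_def; exact: Gn.
  - exact: interior_subset.
  by split => //; rewrite G_def.
have unique := crossing_unique J_itv transv pf_ab dslope nJ' touch.
have r0P p : `|p - p0| < r0 -> P1 p by move=> /hr0[/intP1/P1W].
have s0 : s p0 = p0 by rewrite /s y0 -/(pf _) -p0c.
have s_nup p : `|p - p0| < r0 -> p <> p0 -> n (s p) = n p.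
  move=> pr pp0; have [e1 e2 sab e3 _] := partner _ pr.
  have [pab _] := hr0 _ pr.
  have := (zeros _ _ (nJ _ (r0P _ pr)) ((intP1 _).2 sab)).1 e2.
  by move=> [/e3 e|//]; case: pp0; exact: unique.
have s_inv p : `|p - p0| < r0 -> `|s p - p0| < r0 -> s (s p) = p.
  move=> pr sr; have [->|/eqP pp0] := eqVneq p p0; first by rewrite s0.
  have [e1 _ _ _ _] := partner _ pr.
  have Pp := r0P _ pr; have Jp := nJ _ Pp.
  have G0 : bif_fun phi chi f k p2 (n p) p = 0.
    by rewrite -G_def; apply: Gn; have [] := hr0 _ pr.
  have [_ yy] := zero_return C1 rho_rev phi_slice chi_slice U_iter P_U chi_iter p2_P2
    p2_graph Jp Pp G0.
  rewrite {1}/s /y (s_nup _ pr pp0) -e1 /y yy.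
  by rewrite (section_pi_p1 P_U p2_P2).
have s_cont p : `|p - p0| < r0 -> {for p, continuous s}.
  move=> pr; have [pab [yU _]] := hr0 _ pr.
  apply: (@continuous_comp _ _ _ y (fun x => pi_p1 (cfwd phi x))); first exact: y_cont.
  apply: continuous_comp; first exact: cfwd_cont.
  exact: pi_p1_continuous.
have [r r12 [shape1 shape2 shape3 shape4 shape5]] := pitchfork_shape J_itv dG' dGp' dGpp'
  (fun nu p Jn pab => Cr_cont Gpp1 (DJ nu p Jn pab)) Dprod transv pf_ab pf_cont Gpf dslope
  nJ' n_cont' Gn touch flat p0ab p0c r0_gt0 (fun p h => (hr0 p h).1) s_cont
  (fun p h => let: And5 _ _ sab _ _ := partner p h in sab) s_nup
  (fun p h => let: And5 _ _ _ _ e := partner p h in e) s_inv s0.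
exists (n p0), p0, (p2 (n p0, p0)); split => //.
- exact/P1W/intP1.
- by apply: interior_subset; apply: p2_P2; split => //; exact/P1W/intP1.
have near_r p : `|p - p0| <= r -> `|p - p0| < r0 by lra.
apply: (branches_tupling M_open f_C3 C1 rho_rev J_open phi_coord phi_slice chi_slice U_iter
  xfp_smooth xfp_U xfp_fix P_U p1fp_P1 chi_iter p2_smooth p2_P2 p2_graph xfp_P2 k_ge2 k_even
  _ _ nC' nJ _ p0c shape1 shape2 shape3 shape4).
- by lra.
- by move=> p /near_r/hr0[/intP1].
- by rewrite -G_def.
move=> p q pr qr npq; have [sp sq] := shape5 _ _ pr qr npq.
have pr0 : `|p - p0| < r0 by apply: near_r; rewrite ler_norml; lra.
have qr0 : `|q - p0| < r0 by apply: near_r; rewrite ler_norml; lra.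
have [ep _ _ _ _] := partner _ pr0; have [eq _ _ _ _] := partner _ qr0.
split; first by rewrite -/(y p) ep sp.
by rewrite npq -/(y q) eq sq.
Qed.
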